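(* Let $n$ be a positive integer and let $\mathfrak{A}_n$ be a Banach ideal of $n$-homogeneous polynomials. Then there exists a unique Banach ideal of linear operators $\mathfrak{A}$ such that $\mathfrak{A}_n$ is compatible with $\mathfrak{A}$ (uniqueness being of the class of operators, i.e. of the sets $\mathfrak{A}(E,F)$ for all Banach spaces $E,F$). Moreover, this operator ideal $\mathfrak{A}$ can be given an ideal norm for which the compatibility conditions hold with constants $A,B$ satisfying $1\le A\le e$ and $1\le B\le e$.
   Context: All Banach spaces are complex. $\mathcal{L}(E,F)$ is the Banach space of continuous linear operators from $E$ to $F$ and $\mathcal{P}^n(E,F)$ is the Banach space of continuous $n$-homogeneous polynomials from $E$ to $F$ (sup norm on the unit ball). For $P\in\mathcal{P}^n(E,F)$, $\overset{\vee}{P}$ is the unique symmetric $n$-linear map with $P(x)=\overset{\vee}{P}(x,\dots,x)$, and for $a\in E$, $P_{a^k}\in\mathcal{P}^{n-k}(E,F)$ is defined by $P_{a^k}(x)=\overset{\vee}{P}(a^k,x^{n-k})$ ($a$ repeated $k$ times, $x$ repeated $n-k$ times). For $\gamma\in E'$ and $T\in\mathcal{L}(E,F)$, $\gamma^{n-1}T$ is the $n$-homogeneous polynomial $x\mapsto \gamma(x)^{n-1}T(x)$. A normed ideal of continuous $n$-homogeneous polynomials is a pair $(\mathfrak{A}_n,\|\cdot\|_{\mathfrak{A}_n})$ such that: (i) for all Banach spaces $E,F$, $\mathfrak{A}_n(E,F)=\mathfrak{A}_n\cap\mathcal{P}^n(E,F)$ is a linear subspace of $\mathcal{P}^n(E,F)$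 and $\|\cdot\|_{\mathfrak{A}_n(E,F)}$ is a norm on it; (ii) if $T\in\mathcal{L}(E_1,E)$, $P\in\mathfrak{A}_n(E,F)$, $S\in\mathcal{L}(F,F_1)$, then $S\circ P\circ T\in\mathfrak{A}_n(E_1,F_1)$ and $\|S\circ P\circ T\|_{\mathfrak{A}_n(E_1,F_1)}\le\|S\|\,\|P\|_{\mathfrak{A}_n(E,F)}\|T\|^n$; (iii) $z\mapsto z^n$ belongs to $\mathfrak{A}_n(\mathbb{C},\mathbb{C})$ and has norm $1$. It is a Banach ideal if every $(\mathfrak{A}_n(E,F),\|\cdot\|_{\mathfrak{A}_n(E,F)})$ is complete. A normed (Banach) ideal of linear operators is the case $n=1$; an ideal norm on it is a norm satisfying these conditions. Compatibility: let $\mathfrak{A}$ be a normed ideal of linear operators. A normed ideal $\mathfrak{A}_n$ of $n$-homogeneous polynomials is compatible with $\mathfrak{A}$ if there are positive constants $A,B$ such that for all Banach spaces $E,F$: (i) for each $P\in\mathfrak{A}_n(E,F)$ and $a\in E$, $P_{a^{n-1}}\in\mathfrak{A}(E,F)$ and $\|P_{a^{n-1}}\|_{\mathfrak{A}(E,F)}\le A\|P\|_{\mathfrak{A}_n(E,F)}\|a\|^{n-1}$; (ii) for each $T\in\mathfrak{A}(E,F)$ and $\gamma\in E'$, $\gamma^{n-1}T\in\mathfrak{A}_n(E,F)$ and $\|\gamma^{n-1}T\|_{\mathfrak{A}_n(E,F)}\le B\|\gamma\|^{n-1}\|T\|_{\mathfrak{A}(E,F)}$. *)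

(* Defs.v *)
From HB Require Import structures.
From mathcomp Require Import all_boot all_order all_algebra all_fingroup.
From mathcomp Require Import complex.
From mathcomp Require Import all_classical all_reals all_analysis.

Set Implicit Arguments.
Unset Strict Implicit.
Unset Printing Implicit Defensive.

Import Order.TTheory GRing.Theory Num.Theory.
Import numFieldNormedType.Exports.
Local Open Scope classical_set_scope.
Local Open Scope complex_scope.
Local Open Scope ring_scope.

(* MathComp norms over R[i] take their values in R[i] (as nonnegative reals);
   [rnorm] is the same number seen in R. *)
Definition rnorm (R : realType) (V : normedZmodType R[i]) (x : V) : R :=
  complex.Re `|x|.

Lemma complex_complete (R : realType) (F : set_system R[i]^o) :
  ProperFilter F -> cauchy F -> cvg F.
Proof.
move=> FF /cauchyP Fc.
have leR (x : R[i]) : `|complex.Re x|%:C <= `|x| by exact: normc_ge_Re.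
have leI (x : R[i]) : `|complex.Im x|%:C <= `|x|.
  case: x => a b; rewrite lecR /= -[leLHS]sqrtr_sqr ler_wsqrtr // lerDr.
  exact: sqr_ge0.
have H (g : R[i]^o -> R) : (forall x y, g (x - y) = g x - g y) ->
    (forall x : R[i], `|g x|%:C <= `|x|) -> cvg (g @ F).
  move=> gB gle; apply: R_complete; apply/cauchyP => e e0.
  have e0' : 0 < e%:C by rewrite ltcR.
  have [x Fx] := Fc _ e0'; exists (g x).
  change (F [set y | `|g x - g y| < e]); apply: filterS Fx => y.
  rewrite -ball_normE /= => xy.
  by rewrite -gB -ltcR; apply: le_lt_trans (gle _) xy.
have /cvg_ex[a Fa] := H (@complex.Re R) (fun x y => raddfB _ x y) leR.
have /cvg_ex[b Fb] := H (@complex.Im R) (fun x y => raddfB _ x y) leI.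
apply/cvg_ex; exists (a +i* b); apply/cvgrPdist_lt => e e0.
have er : e = (complex.Re e)%:C by apply/esym/RRe_real/gtr0_real.
have e2 : 0 < complex.Re e / 2 by rewrite divr_gt0// -ltcR -er.
move/cvgrPdist_lt: Fa => /(_ _ e2) Fa; move/cvgrPdist_lt: Fb => /(_ _ e2) Fb.
apply: filterS2 Fa Fb => x xa xb.
have -> : a +i* b - x = (a - complex.Re x)%:C + (b - complex.Im x)%:C * 'i%C.
  by case: x {xa xb} => u v; simpc.
apply: le_lt_trans (ler_normD _ _) _.
rewrite normrM normc_def normc_def [`|'i%C|]normc_def /=.
rewrite !expr0n /= !addr0 add0r expr1n sqrtr1 mulr1 !sqrtr_sqr.
by rewrite er -rmorphD ltcR [ltRHS](splitr (complex.Re e)) ltrD.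
Qed.

HB.instance Definition _ (R : realType) := NormedModule.copy R[i] R[i]^o.

HB.instance Definition _ (R : realType) :=
  Uniform_isComplete.Build R[i] (@complex_complete R).

Section Definitions.
Variable R : realType.

Notation banach := (completeNormedModType R[i]).
Notation Cb := (R[i] : banach).

Definition continuous_linear (E F : banach) (T : E -> F) : Prop :=
  linear T /\ continuous T.

Definition unit_ball_norm (E F : banach) (f : E -> F) : R :=
  sup [set rnorm (f x) | x in [set x : E | rnorm x <= 1]].

Definition multilinear (n : nat) (E F : banach) (phi : ('I_n -> E) -> F) : Prop :=
  forall (v : 'I_n -> E) (i : 'I_n),
    linear (fun x : E => phi (fun j => if j == i then x else v j)).

Definition symmetric_map (n : nat) (E F : banach) (phi : ('I_n -> E) -> F) : Prop :=
  forall (s : 'S_n) (v : 'I_n -> E), phi (fun i => v (s i)) = phi v.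

Definition polar_of (n : nat) (E F : banach) (P : E -> F)
    (phi : ('I_n -> E) -> F) : Prop :=
  [/\ multilinear phi, symmetric_map phi & forall x : E, P x = phi (fun=> x)].

(* Continuity of [P] is equivalent to continuity of its symmetric n-linear map. *)
Definition hom_poly (n : nat) (E F : banach) (P : E -> F) : Prop :=
  continuous P /\ exists phi : ('I_n -> E) -> F, polar_of P phi.

(* The symmetric n-linear map of [P] (the zero map if [P] has none). *)
Definition polar (n : nat) (E F : banach) (P : E -> F) : ('I_n -> E) -> F :=
  xget (fun=> 0) [set phi | polar_of P phi].

Definition poly_fix (n k : nat) (E F : banach) (P : E -> F) (a : E) : E -> F :=
  fun x => polar P (fun i : 'I_n => if (i < k)%N then a else x).

Definition power_mul (k : nat) (E F : banach) (gamma : E -> Cb) (T : E -> F) :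
    E -> F :=
  fun x => (gamma x ^+ k : R[i]) *: T x.

Definition map_class : Type := forall E F : banach, set (E -> F).

(* Values at maps outside of the accompanying class are irrelevant. *)
Definition class_norm : Type := forall E F : banach, (E -> F) -> R.

Record normed_ideal (n : nat) (A : map_class) (N : class_norm) : Prop := {
  ideal_hom_poly : forall (E F : banach) (P : E -> F), A E F P -> hom_poly n P;
  ideal_zero : forall E F : banach, A E F (fun=> 0);
  ideal_lin : forall (E F : banach) (c : R[i]) (P Q : E -> F),
    A E F P -> A E F Q -> A E F (fun x => c *: P x + Q x);
  ideal_norm_ge0 : forall (E F : banach) (P : E -> F), A E F P -> 0 <= N E F P;
  ideal_norm_eq0 : forall (E F : banach) (P : E -> F),
    A E F P -> N E F P = 0 -> P = (fun=> 0);
  ideal_normZ : forall (E F : banach) (c : R[i]) (P : E -> F),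
    A E F P -> N E F (fun x => c *: P x) = rnorm c * N E F P;
  ideal_normD : forall (E F : banach) (P Q : E -> F), A E F P -> A E F Q ->
    N E F (fun x => P x + Q x) <= N E F P + N E F Q;
  ideal_comp : forall (E1 E F F1 : banach)
      (T : E1 -> E) (P : E -> F) (S : F -> F1),
    continuous_linear T -> A E F P -> continuous_linear S ->
    A E1 F1 (S \o P \o T) /\
    N E1 F1 (S \o P \o T) <=
      unit_ball_norm S * N E F P * unit_ball_norm T ^+ n;
  ideal_pow : A Cb Cb (fun z : R[i] => z ^+ n) /\
              N Cb Cb (fun z : R[i] => z ^+ n) = 1
}.

Definition complete_class (A : map_class) (N : class_norm) : Prop :=
  forall (E F : banach) (u : nat -> E -> F),
    (forall k, A E F (u k)) ->
    (forall eps : R, 0 < eps -> exists m : nat, forall i j : nat,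
       (m <= i)%N -> (m <= j)%N -> N E F (fun x => u i x - u j x) < eps) ->
    exists2 P : E -> F, A E F P &
      (N E F (fun x => u k x - P x) @[k --> \oo] --> (0 : R)).

Definition banach_ideal (n : nat) (A : map_class) (N : class_norm) : Prop :=
  normed_ideal n A N /\ complete_class A N.

Definition compatible_with_constants (n : nat) (An : map_class)
    (Nn : class_norm) (A : map_class) (N : class_norm) (cA cB : R) : Prop :=
  forall E F : banach,
    (forall (P : E -> F) (a : E), An E F P ->
       A E F (poly_fix n n.-1 P a) /\
       N E F (poly_fix n n.-1 P a) <= cA * Nn E F P * rnorm a ^+ n.-1) /\
    (forall (T : E -> F) (gamma : E -> Cb),
       A E F T -> continuous_linear gamma ->
       An E F (power_mul n.-1 gamma T) /\
       Nn E F (power_mul n.-1 gamma T) <=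
         cB * unit_ball_norm gamma ^+ n.-1 * N E F T).

Definition compatible (n : nat) (An : map_class) (Nn : class_norm)
    (A : map_class) (N : class_norm) : Prop :=
  exists cA cB : R,
    [/\ 0 < cA, 0 < cB & compatible_with_constants n An Nn A N cA cB].

End Definitions.

(* Main.v *)
(** [An] determines the operators [T] all of whose multiples
    [gamma^(n-1) (T o U)] lie in [An], uniformly over contractions [gamma], [U]
    with a common domain; letting [U] vary makes the bound an ideal norm.
    If [P] is in [An], averaging [P(U x + s w^j gamma(x) a)] against [w^(2j)],
    for [w] a primitive root of unity of order [n + 1], extracts
    [gamma^(n-1) (P_{a^(n-1)} o U)] with norm at most
    [(1 + t)^n / (n t^(n-1)) <= e] at [t = n - 1]. The norm of the identity of
    the scalars is then in [[1, e]], and dividing by it restores the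
    normalization at the cost of [1 <= B <= e]. Uniqueness: for
    [P = gamma^(n-1) T] and [gamma(b) = 1], [n P_{b^(n-1)}] differs from [T] by
    a rank-one operator. Norming functionals (Hahn-Banach) show that ideal
    convergence implies pointwise convergence, whence completeness. *)
From HB Require Import structures.
Require Import Defs.
From mathcomp Require Import all_boot all_order all_algebra perm.
From mathcomp Require Import complex.
From mathcomp Require Import all_classical all_reals all_analysis.
From mathcomp Require Import cyclic separable cyclotomic zify ring lra.

Set Implicit Arguments.
Unset Strict Implicit.
Unset Printing Implicit Defensive.

Import Order.TTheory GRing.Theory Num.Theory.
Import numFieldNormedType.Exports.
Local Open Scope classical_set_scope.
Local Open Scope complex_scope.
Local Open Scope ring_scope.

(** * The real Hahn-Banach theorem for sublinear functionals *)

Section HahnBanach.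
Variables (R : realType) (V : lmodType R).
Implicit Types (p q : V -> R) (x y : V).

Definition sublinear p :=
  (forall x y, p (x + y) <= p x + p y) /\
  (forall (t : R) x, 0 <= t -> p (t *: x) = t * p x).

Lemma sublinear0 p : sublinear p -> p 0 = 0.
Proof. by case=> _ pZ; rewrite -(scale0r (0 : V)) pZ// mul0r. Qed.

Lemma sublinearN p x : sublinear p -> - p (- x) <= p x.
Proof.
move=> ps; have := sublinear0 ps; case: ps => pD _.
by have := pD x (- x); rewrite subrr; lra.
Qed.

(** Half of positive homogeneity suffices: the inequality for [t^-1] at [t *: x] is the reverse
    inequality for [t] at [x]. *)
Lemma scaled_sublinear p :
  (forall x y, p (x + y) <= p x + p y) ->
  (forall (t : R) x, 0 < t -> p (t *: x) <= t * p x) -> p 0 = 0 ->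
  sublinear p.
Proof.
move=> pD pZ p0; split=> // t x; rewrite le_eqVlt => /predU1P[<-|t0].
  by rewrite scale0r mul0r.
apply/le_anti; rewrite pZ//=.
have := pZ t^-1 (t *: x); rewrite invr_gt0 => /(_ t0).
by rewrite scalerA mulVf ?gt_eqF// scale1r ler_pdivlMl.
Qed.

(** For sublinear [p], this lies below [p] (take [t = 0]) and is at most [- p y] at [- y] (take
    [t = 1]), so a linear functional below it agrees with [p] at [y]. *)
Definition lower_slope p y x :=
  inf [set p (x + t *: y) - t * p y | t in [set t : R | 0 <= t]].

Lemma has_inf_lower_slope p y x : sublinear p ->
  has_inf [set p (x + t *: y) - t * p y | t in [set t : R | 0 <= t]].
Proof.
move=> ps; split; first by exists (p (x + 0 *: y) - 0 * p y), 0 => //=.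
exists (- p (- x)) => _ [t /= t0 <-].
have [pD pZ] := ps; have := pD (x + t *: y) (- x).
by rewrite addrC addKr pZ//; lra.
Qed.

Lemma lower_slope_le p y x t : sublinear p -> 0 <= t ->
  lower_slope p y x <= p (x + t *: y) - t * p y.
Proof.
move=> ps t0; apply: ge_inf; last by exists t.
by case: (has_inf_lower_slope y x ps).
Qed.

Lemma lower_slopeP p y x (c : R) : sublinear p ->
  (forall t : R, 0 <= t -> c <= p (x + t *: y) - t * p y) ->
  c <= lower_slope p y x.
Proof.
move=> ps H; apply: lb_le_inf; first by case: (has_inf_lower_slope y x ps).
by move=> _ [t /= t0 <-]; exact: H.
Qed.

(** Parameters [t] for [x1] and [s] for [x2] combine into [t + s] for [x1 + x2]; a parameter [s] for
    [x] becomes [t * s] for [t *: x]. *)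
Lemma lower_slope_sublinear p y : sublinear p -> sublinear (lower_slope p y).
Proof.
move=> ps; have [pD pZ] := ps; apply: scaled_sublinear.
- move=> x1 x2; rewrite -lerBlDr; apply: lower_slopeP => // t t0.
  rewrite lerBlDr [leRHS]addrC -lerBlDr; apply: lower_slopeP => // s s0.
  have := lower_slope_le y (x1 + x2) ps (addr_ge0 t0 s0).
  have := pD (x1 + t *: y) (x2 + s *: y).
  by rewrite addrACA -scalerDl; lra.
- move=> t x t0; rewrite -ler_pdivrMl//; apply: lower_slopeP => // s s0.
  rewrite ler_pdivrMl//.
  have := lower_slope_le y (t *: x) ps (mulr_ge0 (ltW t0) s0).
  by rewrite -scalerA -scalerDr (pZ _ _ (ltW t0)); lra.
- apply/le_anti/andP; split.
    have := lower_slope_le y 0 ps (lexx 0).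
    by rewrite scale0r addr0 mul0r subr0 (sublinear0 ps).
  by apply: lower_slopeP => // t t0; rewrite add0r pZ// subrr.
Qed.

(** Subadditivity is where the chain condition enters: given [q1] used at [x] and [q2] at [y], the
    smaller of the two bounds both terms. The lower bound [- p (- x)] keeps the infimum finite. *)
Lemma sublinear_inf p (S : set (V -> R)) : sublinear p -> S !=set0 ->
  (forall q, S q -> sublinear q /\ forall x, q x <= p x) ->
  (forall q1 q2, S q1 -> S q2 ->
     (forall x, q1 x <= q2 x) \/ (forall x, q2 x <= q1 x)) ->
  sublinear (fun x => inf [set q x | q in S]) /\
  (forall q x, S q -> inf [set q x | q in S] <= q x).
Proof.
move=> ps S0 Sp tot.
have hl x : has_lbound [set q x | q in S].
  exists (- p (- x)) => _ [q Sq <-]; have [qs qp] := Sp _ Sq.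
  by apply: le_trans (sublinearN x qs); rewrite lerN2.
have le q x : S q -> inf [set q x | q in S] <= q x.
  by move=> Sq; apply: ge_inf => //; exists q.
have ge (c : R) x : (forall q, S q -> c <= q x) -> c <= inf [set q x | q in S].
  move=> H; apply: lb_le_inf => [|_ [q Sq <-]]; last exact: H.
  by have [q Sq] := S0; exists (q x), q.
split=> //; apply: scaled_sublinear.
- move=> x y /=; rewrite -lerBlDr; apply: (ge) => q1 S1.
  rewrite lerBlDr [leRHS]addrC -lerBlDr; apply: (ge) => q2 S2; rewrite lerBlDr.
  have [[qD1 _] _] := Sp _ S1; have [[qD2 _] _] := Sp _ S2.
  case: (tot _ _ S1 S2) => h.
    by apply: (le_trans (le _ _ S1)); have := qD1 x y; have := h y; lra.
  by apply: (le_trans (le _ _ S2)); have := qD2 x y; have := h x; lra.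
- move=> t x t0 /=; rewrite -ler_pdivrMl//; apply: (ge) => q Sq.
  rewrite ler_pdivrMl//; have [[_ qZ] _] := Sp _ Sq.
  by rewrite -(qZ _ _ (ltW t0)); exact: le.
- have [q Sq] := S0; apply/le_anti/andP; split.
    by have [qs _] := Sp _ Sq; rewrite -(sublinear0 qs); exact: le.
  by apply: (ge) => q' /Sp[/sublinear0-> _].
Qed.

(* Zorn's lemma is applied to the functionals themselves; a minimal one is
   linear because [lower_slope] cannot lie strictly below it. *)
Lemma minimal_sublinear p : sublinear p -> exists2 f : V -> R,
  sublinear f /\ (forall x, f x <= p x) &
  forall q, sublinear q -> (forall x, q x <= f x) -> q = f.
Proof.
move=> ps.
pose T := {q : V -> R | sublinear q /\ forall x, q x <= p x}.
pose Rel (q1 q2 : T) := `[< forall x, sval q2 x <= sval q1 x >].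
have [|||S tot|[f [fs fp]] fmax] := @Zorn T Rel.
- by move=> q; apply/asboolP => x.
- move=> q1 q2 q3 /asboolP h12 /asboolP h23; apply/asboolP => x.
  exact: le_trans (h23 x) (h12 x).
- move=> [q1 h1] [q2 h2] /asboolP /= h12 /asboolP /= h21.
  have e : q1 = q2 by apply/funext => x; apply/le_anti; rewrite h12 h21.
  by case: _ / e h2 {h12 h21} => h2; congr exist; exact: Prop_irrelevance.
- have [S0|S0] := pselect (S !=set0); last first.
    exists (exist (fun q => sublinear q /\ forall x, q x <= p x) p
      (conj ps (fun=> lexx _))) => s Ss.
    by case: S0; exists s.
  have [|||infs infle] :=
    @sublinear_inf p [set (sval q : V -> R) | q in S] ps.
  + by have [s Ss] := S0; exists (sval s), s.
  + by move=> _ [[q qp] /= _ <-].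
  + move=> _ _ [q1 S1 <-] [q2 S2 <-].
    by case: (tot _ _ S1 S2) => /asboolP h; [right|left].
  have [s Ss] := S0.
  have infp x :
      inf [set q x | q in [set (sval q : V -> R) | q in S]] <= p x.
    apply: (le_trans (infle (sval s) x _)); first by exists s.
    by case: s {Ss} => q [].
  exists (exist (fun q => sublinear q /\ forall x, q x <= p x) _
    (conj infs infp)) => q Sq; apply/asboolP => x /=.
  by apply: infle; exists q.
exists f => // q qs qf.
have qp x : q x <= p x by exact: le_trans (qf x) (fp x).
by have /(_ (introT (asboolP _) qf))/(congr1 sval) :=
  fmax (exist _ q (conj qs qp)).
Qed.

(** The minimal functional is taken below [lower_slope p x0] rather than below [p], which forces
    equality with [p] at [x0]. *)
Theorem hahn_banach p x0 : sublinear p -> exists f : V -> R,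
  [/\ forall x y, f (x + y) = f x + f y, forall (t : R) x, f (t *: x) = t * f x,
      forall x, f x <= p x & f x0 = p x0].
Proof.
move=> ps; have [f [fs fp] fmin] :=
  minimal_sublinear (lower_slope_sublinear x0 ps).
have fle x : f x <= p x.
  apply: (le_trans (fp x)); have := lower_slope_le x0 x ps (lexx 0).
  by rewrite scale0r addr0 mul0r subr0.
have fD x y : f (x + y) = f x + f y.
  have [fD _] := fs; apply/le_anti; rewrite fD /=.
  (* Minimality forbids a strictly smaller [lower_slope f y]; the parameter [t = 1] then gives
     [f x + f y <= f (x + y)]. *)
  have slope_f : lower_slope f y = f.
    apply: fmin => [|z]; first exact: lower_slope_sublinear.
    have := lower_slope_le y z fs (lexx 0).
    by rewrite scale0r addr0 mul0r subr0.
  by have := lower_slope_le y x fs ler01; rewrite slope_f scale1r mul1r; lra.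
have fN x : f (- x) = - f x.
  by have := fD x (- x); rewrite subrr sublinear0//; lra.
have [_ fZ] := fs.
exists f; split=> //.
  move=> t x; have [t0|t0] := leP 0 t; first exact: fZ.
  by rewrite -[t]opprK scaleNr fN (fZ (- t)) ?oppr_ge0 ?ltW// !mulNr.
apply/le_anti; rewrite fle /=.
have := fp (- x0); have := lower_slope_le x0 (- x0) ps ler01.
by rewrite scale1r addNr mul1r (sublinear0 ps) fN; lra.
Qed.

End HahnBanach.

(** * Norms of complex spaces as real numbers *)

Section RealNorm.
Variable R : realType.

Lemma normr_rnorm (V : normedZmodType R[i]) (x : V) : `|x| = (rnorm x)%:C.
Proof. by apply/esym/RRe_real/ger0_real. Qed.

Lemma rnorm_ge0 (V : normedZmodType R[i]) (x : V) : 0 <= rnorm x.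
Proof. by rewrite -lecR -normr_rnorm; exact: normr_ge0. Qed.

Lemma rnormE (V : normedZmodType R[i]) (x : V) (r : R) :
  `|x| = r%:C -> rnorm x = r.
Proof. by rewrite /rnorm => ->. Qed.

Lemma rnorm0 (V : normedZmodType R[i]) : rnorm (0 : V) = 0.
Proof. by apply: rnormE; rewrite normr0. Qed.

Lemma rnorm_eq0 (V : normedZmodType R[i]) (x : V) : (rnorm x == 0) = (x == 0).
Proof. by rewrite -[RHS]normr_eq0 normr_rnorm (inj_eq (@complexI R)). Qed.

Lemma rnormD (V : normedZmodType R[i]) (x y : V) :
  rnorm (x + y) <= rnorm x + rnorm y.
Proof. by rewrite -lecR rmorphD /= -!normr_rnorm ler_normD. Qed.

Lemma rnormN (V : normedZmodType R[i]) (x : V) : rnorm (- x) = rnorm x.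
Proof. by rewrite /rnorm normrN. Qed.

Lemma rnormZ (V : normedModType R[i]) (c : R[i]) (x : V) :
  rnorm (c *: x) = rnorm c * rnorm x.
Proof. by apply: rnormE; rewrite normrZ !normr_rnorm rmorphM. Qed.

Lemma rnormM (c d : R[i]) : rnorm (c * d) = rnorm c * rnorm d.
Proof. by apply: rnormE; rewrite normrM !normr_rnorm rmorphM. Qed.

Lemma rnorm1 : rnorm (1 : R[i]) = 1.
Proof. by apply: rnormE; rewrite normr1. Qed.

Lemma rnormX (c : R[i]) k : rnorm (c ^+ k) = rnorm c ^+ k.
Proof. by apply: rnormE; rewrite normrX !normr_rnorm rmorphXn. Qed.

Lemma rnormR (t : R) : rnorm (t%:C) = `|t|.
Proof. by apply: rnormE; rewrite normc_def /= expr0n /= addr0 sqrtr_sqr. Qed.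

Lemma Re_le_rnorm (c : R[i]) : complex.Re c <= rnorm c.
Proof.
apply: (le_trans (ler_norm _)); rewrite -lecR -normr_rnorm.
exact: normc_ge_Re.
Qed.

Lemma rnorm_phase (c : R[i]) : exists2 u : R[i], rnorm u = 1 & u * c = (rnorm c)%:C.
Proof.
have [->|c0] := eqVneq c 0.
  by exists 1; rewrite ?rnorm1 ?rnorm0 ?mulr0.
have rc0 : rnorm c != 0 by rewrite rnorm_eq0.
exists ((rnorm c)%:C / c); last by rewrite divfK.
apply: rnormE; rewrite normf_div [`|c|]normr_rnorm.
rewrite ger0_norm ?lecR ?rnorm_ge0// divff//.
by rewrite (inj_eq (@complexI R) _ 0).
Qed.

End RealNorm.

(** * Restriction of scalars and the complex Hahn-Banach theorem *)

Section Realification.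
Variable R : realType.

(** An alias, so that the real scalar action does not compete with the complex one on the same
    type. *)
Definition realified (V : lmodType R[i]) : Type := V.

Variable V : lmodType R[i].

HB.instance Definition _ := GRing.Zmodule.on (realified V).

Let rscale (t : R) (x : realified V) : realified V := t%:C *: (x : V).

Let rscaleA s t x : rscale s (rscale t x) = rscale (s * t) x.
Proof. by rewrite /rscale scalerA rmorphM. Qed.

Let rscale1 : left_id 1 rscale.
Proof. by move=> x; rewrite /rscale scale1r. Qed.

Let rscaleDr : right_distributive rscale +%R.
Proof. by move=> t x y; rewrite /rscale scalerDr. Qed.

Let rscaleDl x : {morph rscale^~ x : s t / s + t}.
Proof. by move=> s t; rewrite /rscale rmorphD scalerDl. Qed.

HB.instance Definition _ := GRing.Zmodule_isLmodule.Build R (realified V)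
  rscaleA rscale1 rscaleDr rscaleDl.

Lemma realified_scaleE (t : R) (x : V) :
  t *: (x : realified V) = t%:C *: x :> V.
Proof. by []. Qed.

End Realification.

(** A real functional [f] below the norm is the real part of [phi x = f x - i f (i x)]. If [u] is
    unimodular and [u * phi x] is the modulus of [phi x], that modulus is [f (u *: x)], so the bound
    on [f] passes to [phi]. *)
Theorem complex_hahn_banach (R : realType) (V : normedModType R[i]) (x0 : V) :
  exists phi : V -> R[i],
    [/\ linear (phi : V -> R[i]^o), forall x, rnorm (phi x) <= rnorm x
      & rnorm (phi x0) = rnorm x0].
Proof.
have rnorm_sublin : sublinear (fun x : realified V => rnorm (x : V)).
  split=> [x y|t x t0]; first exact: rnormD.
  by rewrite realified_scaleE rnormZ rnormR ger0_norm.
have [f [fD fZ fle fx0]] := hahn_banach (x0 : realified V) rnorm_sublin.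
have {}fZ (t : R) (x : V) : f (t%:C *: x) = t * f x by exact: fZ.
have {}fD (x y : V) : f (x + y) = f x + f y by exact: fD.
pose phi (x : V) : R[i] := f x +i* - f ('i%C *: x).
have phiD x y : phi (x + y) = phi x + phi y.
  by rewrite /phi scalerDr !fD opprD; simpc.
have fN x : f (- x) = - f x.
  by have := fZ (-1) x; rewrite rmorphN scaleN1r mulN1r.
have phiZ c x : phi (c *: x) = c * phi x.
  case: c => a b; rewrite /phi.
  have -> : a +i* b = a%:C + b%:C * 'i%C by simpc.
  rewrite scalerDl scalerDr !scalerA ['i%C * a%:C]mulrC mulrCA -expr2.
  rewrite sqr_i mulrN1 scaleNr -!scalerA !fD fN !fZ; simpc.
  by congr (_ +i* _); ring.
have phi_le x : rnorm (phi x) <= rnorm x.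
  have [u u1 ux] := rnorm_phase (phi x).
  have <- : f (u *: x) = rnorm (phi x).
    by have := phiZ u x; rewrite ux => /(congr1 (@complex.Re R)).
  by apply: (le_trans (fle _)); rewrite rnormZ u1 mul1r.
exists phi; split=> //.
  by move=> c x y; rewrite phiD phiZ.
apply/le_anti; rewrite phi_le -[leLHS]fx0 /=; exact: (Re_le_rnorm (phi x0)).
Qed.

(** * Bounded operators and norming functionals *)

Section BoundedOperators.
Variable R : realType.

Notation banach := (completeNormedModType R[i]).
Notation Cb := (R[i] : banach).

Section OneOperator.
Variables (E F : banach) (T : E -> F).
Hypothesis linT : linear T.

Lemma linear_fun0 : T 0 = 0.
Proof.
by have := linT (-1) 0 0; rewrite scaler0 addr0 scaleN1r addNr.
Qed.

Lemma linear_funZ c x : T (c *: x) = c *: T x.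
Proof. by have := linT c x 0; rewrite !addr0 linear_fun0 addr0. Qed.

Lemma linear_funD x y : T (x + y) = T x + T y.
Proof. by have := linT 1 x y; rewrite !scale1r. Qed.

Lemma linear_funB x y : T (x - y) = T x - T y.
Proof. by rewrite linear_funD -scaleN1r linear_funZ scaleN1r. Qed.

End OneOperator.

(** Any upper bound on the operator norm is allowed, so that bounds multiply and add without
    handling suprema. *)
Definition lin_bound (E F : banach) (M : R) (T : E -> F) :=
  linear T /\ forall x, rnorm (T x) <= M * rnorm x.

Lemma lin_bound_continuous (E F : banach) (M : R) (T : E -> F) :
  lin_bound M T -> continuous_linear T.
Proof.
move=> [linT bT]; split=> // x; apply/cvgrPdist_lt => e e0.
have er : e = (complex.Re e)%:C by apply/esym/RRe_real/gtr0_real.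
have e1 : 0 < complex.Re e by rewrite -ltcR -er.
(* [M] may be zero or negative, whereas a positive divisor is needed. *)
pose K := `|M| + 1; have K0 : 0 < K by rewrite ltr_wpDl.
have d0 : 0 < (complex.Re e / K)%:C by rewrite ltcR divr_gt0.
apply/nbhs_ballP; exists (complex.Re e / K)%:C => //= y.
rewrite -ball_normE /= !normr_rnorm ltcR ltr_pdivlMr// => h.
rewrite -(linear_funB linT) er ltcR; apply: le_lt_trans h.
apply: (le_trans (bT _)); rewrite mulrC ler_wpM2l ?rnorm_ge0//.
by rewrite (le_trans (ler_norm M))// lerDl.
Qed.

Lemma unit_ball_norm_le (E F : banach) (M : R) (f : E -> F) : 0 <= M ->
  (forall x, rnorm (f x) <= M * rnorm x) -> unit_ball_norm f <= M.
Proof.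
move=> M0 bf; apply: ge_sup.
  by exists (rnorm (f 0)), 0; rewrite ?/=; rewrite ?rnorm0 ?ler01.
move=> _ [x /= x1 <-]; apply: (le_trans (bf x)).
by rewrite -[leRHS]mulr1 ler_wpM2l.
Qed.

Lemma continuous_lin_bound (E F : banach) (T : E -> F) : continuous_linear T ->
  0 <= unit_ball_norm T /\ lin_bound (unit_ball_norm T) T.
Proof.
move=> [linT cT].
(* A first bound, [2 / r] for a radius [r] given by continuity at 0, shows that the supremum
   defining [unit_ball_norm T] is over a bounded set. *)
have [M M0 bM] : exists2 M, 0 <= M & forall x, rnorm (T x) <= M * rnorm x.
  have /cvgrPdist_lt/(_ 1 ltr01) := cT 0.
  move=> /nbhs_ballP[d /= d0 bd].
  have dr : d = (complex.Re d)%:C by apply/esym/RRe_real/gtr0_real.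
  have {}d0 : 0 < complex.Re d by rewrite -ltcR -dr.
  set r := complex.Re d in dr d0.
  have small y : rnorm y < r -> rnorm (T y) < 1.
    move=> yr; have := bd y; rewrite -ball_normE /= dr normr_rnorm ltcR.
    rewrite sub0r rnormN => /(_ yr).
    by rewrite linear_fun0// sub0r normr_rnorm rnormN -ltcR.
  exists (2 / r) => [|x]; first by rewrite divr_ge0// ltW.
  have [->|x0] := eqVneq x 0; first by rewrite linear_fun0// !rnorm0 mulr0.
  have nx0 : 0 < rnorm x by rewrite lt_def rnorm_eq0 x0 rnorm_ge0.
  have := small ((r / 2 / rnorm x)%:C *: x).
  rewrite linear_funZ// !rnormZ !rnormR ger0_norm; last first.
    by rewrite !divr_ge0// ltW.
  rewrite divfK ?gt_eqF// => /(_ _)/ltW h.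
  have {}h : r / 2 / rnorm x * rnorm (T x) <= 1 by apply: h; lra.
  have e : 2 / r * rnorm x * (r / 2 / rnorm x) = 1.
    by field; rewrite !gt_eqF.
  have c0 : 0 <= 2 / r * rnorm x by rewrite !mulr_ge0// ?invr_ge0 ltW.
  by have := ler_wpM2l c0 h; rewrite mulrA e mul1r mulr1.
have bnd x : rnorm x <= 1 -> rnorm (T x) <= unit_ball_norm T.
  move=> x1; apply: ub_le_sup; last by exists x.
  exists M => _ [y /= y1 <-]; apply: (le_trans (bM y)).
  by rewrite -[leRHS]mulr1 ler_wpM2l.
split; first by apply: le_trans (bnd 0 _); rewrite ?rnorm_ge0 ?rnorm0.
split=> // x; have [->|x0] := eqVneq x 0.
  by rewrite linear_fun0// !rnorm0 mulr0.
have nx0 : 0 < rnorm x by rewrite lt_def rnorm_eq0 x0 rnorm_ge0.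
have := bnd (((rnorm x)^-1)%:C *: x).
rewrite linear_funZ// !rnormZ !rnormR ger0_norm ?invr_ge0 ?rnorm_ge0//.
by rewrite mulVf ?gt_eqF// lexx => /(_ isT); rewrite ler_pdivrMl// mulrC.
Qed.

Lemma lin_bound_le (E F : banach) (M K : R) (T : E -> F) : M <= K ->
  lin_bound M T -> lin_bound K T.
Proof.
move=> MK [linT bT]; split=> // x; apply: (le_trans (bT x)).
by rewrite ler_wpM2r ?rnorm_ge0.
Qed.

Lemma lin_bound_id (E : banach) : lin_bound 1 (@id E).
Proof. by split=> // x; rewrite mul1r. Qed.

Lemma lin_bound_comp (E F G : banach) (M K : R) (T : E -> F) (S : F -> G) :
  0 <= K -> lin_bound M T -> lin_bound K S -> lin_bound (K * M) (S \o T).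
Proof.
move=> K0 [linT bT] [linS bS]; split=> [c x y|x] /=; first by rewrite linT linS.
by apply: (le_trans (bS _)); rewrite -mulrA ler_wpM2l.
Qed.

Lemma lin_boundD (E F : banach) (M K : R) (T S : E -> F) :
  lin_bound M T -> lin_bound K S -> lin_bound (M + K) (fun x => T x + S x).
Proof.
move=> [linT bT] [linS bS]; split=> [c x y|x].
  by rewrite linT linS scalerDr addrACA.
by apply: (le_trans (rnormD _ _)); rewrite mulrDl lerD.
Qed.

Lemma lin_boundZ (E F : banach) (M : R) (c : R[i]) (T : E -> F) :
  lin_bound M T -> lin_bound (rnorm c * M) (fun x => c *: T x).
Proof.
move=> [linT bT]; split=> [d x y|x].
  by rewrite linT scalerDr !scalerA mulrC.
by rewrite rnormZ -mulrA ler_wpM2l ?rnorm_ge0.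
Qed.

Lemma lin_bound_rank1 (E F : banach) (M : R) (gamma : E -> Cb) (a : F) :
  lin_bound M gamma -> lin_bound (M * rnorm a) (fun x => (gamma x : R[i]) *: a).
Proof.
move=> [ling bg]; split=> [c x y|x].
  by rewrite ling scalerDl scalerA.
by rewrite rnormZ mulrAC ler_wpM2r ?rnorm_ge0.
Qed.

Lemma lin_bound_line (E : banach) (x : E) :
  lin_bound (rnorm x) (fun z : Cb => (z : R[i]) *: x).
Proof. by rewrite -[rnorm x]mul1r; exact: lin_bound_rank1 (lin_bound_id _). Qed.

Lemma norming_functional (E : banach) (x : E) :
  exists2 phi : E -> Cb, lin_bound 1 phi & rnorm (phi x) = rnorm x.
Proof.
have [phi [linphi bphi phix]] := complex_hahn_banach x.
by exists phi => //; split=> // y; rewrite mul1r.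
Qed.

Lemma dual_separates (E : banach) (x : E) : x != 0 ->
  exists2 phi : E -> Cb, lin_bound 1 phi & phi x != 0.
Proof.
move=> x0; have [phi bphi e] := norming_functional x; exists phi => //.
by rewrite -rnorm_eq0 e rnorm_eq0.
Qed.

End BoundedOperators.

(** * Homogeneity and elementary properties of normed ideals *)

Section NormedIdeals.
Variable R : realType.

Notation banach := (completeNormedModType R[i]).
Notation Cb := (R[i] : banach).

(** Scalars leave one slot at a time. Stopping at [k] serves both the homogeneity of [P] ([k = n])
    and that of [poly_fix] in [a] ([k = n - 1]). *)
Lemma multilinear_scale n (E F : banach) (phi : ('I_n -> E) -> F) (c : R[i])
    (v : 'I_n -> E) (k : nat) : multilinear phi -> (k <= n)%N ->
  phi (fun i => if (i < k)%N then c *: v i else v i) = c ^+ k *: phi v.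
Proof.
move=> mphi; elim: k => [|k IHk] kn; first by rewrite scale1r.
rewrite [RHS](_ : _ = c *: (c ^+ k *: phi v)); last first.
  by rewrite scalerA -exprS.
rewrite -(IHk (ltnW kn)).
pose w (i : 'I_n) := if (i < k)%N then c *: v i else v i.
pose ik := Ordinal kn.
have := linear_funZ (mphi w ik) c (v ik).
congr (_ = c *: _); congr phi; apply/funext => j; rewrite -val_eqE /= /w.
  rewrite ltnS [(j <= k)%N]leq_eqVlt; case: eqP => //= jk.
  by congr (_ *: v _); exact: val_inj.
by case: eqP => // jk; rewrite jk ltnn; congr v; exact: val_inj.
Qed.

Lemma hom_poly_homogeneous n (E F : banach) (P : E -> F) (c : R[i]) (x : E) :
  hom_poly n P -> P (c *: x) = c ^+ n *: P x.
Proof.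
move=> [_ [phi [mphi _ Pphi]]]; rewrite !Pphi.
rewrite -(multilinear_scale c (fun=> x) mphi (leqnn n)).
by congr phi; apply/funext => i; rewrite ltn_ord.
Qed.

Lemma hom_poly1 (E F : banach) (T : E -> F) :
  hom_poly 1 T <-> continuous_linear T.
Proof.
split=> [[cT [phi [mphi _ Tphi]]]|[linT cT]].
  split=> // c x y; rewrite !Tphi.
  have := mphi (fun=> 0) ord0 c x y.
  by congr (_ = c *: _ + _); congr phi; apply/funext => j; rewrite ord1.
split=> //; exists (fun v => T (v ord0)); split=> // [v i|s v].
  by rewrite (ord1 i) /=; exact: linT.
by rewrite (ord1 (s ord0)).
Qed.

Variables (n : nat) (A : map_class R) (N : class_norm R).
Arguments A : clear implicits.
Arguments N : clear implicits.
Hypothesis idealA : normed_ideal n A N.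

Lemma ideal_lin_bound (E1 E F F1 : banach) (t s : R)
    (T : E1 -> E) (P : E -> F) (S : F -> F1) :
  0 <= t -> 0 <= s -> lin_bound t T -> A E F P -> lin_bound s S ->
  A E1 F1 (S \o P \o T) /\ N E1 F1 (S \o P \o T) <= s * N E F P * t ^+ n.
Proof.
move=> t0 s0 bT AP bS.
have cT := lin_bound_continuous bT; have cS := lin_bound_continuous bS.
have [AQ leQ] := ideal_comp idealA cT AP cS; split=> //.
have [T0 _] := continuous_lin_bound cT; have [S0 _] := continuous_lin_bound cS.
have NP0 := ideal_norm_ge0 idealA AP.
apply: (le_trans leQ); apply: ler_pM; rewrite ?mulr_ge0 ?exprn_ge0//.
  by rewrite ler_wpM2r// unit_ball_norm_le//; case: bS.
by rewrite lerXn2r ?nnegrE// unit_ball_norm_le//; case: bT.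
Qed.

Lemma ideal_precomp (E1 E F : banach) (t : R) (T : E1 -> E) (P : E -> F) :
  0 <= t -> lin_bound t T -> A E F P ->
  A E1 F (P \o T) /\ N E1 F (P \o T) <= N E F P * t ^+ n.
Proof.
move=> t0 bT AP.
have := ideal_lin_bound t0 ler01 bT AP (lin_bound_id F).
by rewrite mul1r.
Qed.

(** Composing [P] with the line through [x] and a functional [phi] norming [P x] gives
    [phi (P x) z^n] on the scalars, whose ideal norm is the norm of [P x] because [z^n] has norm
    1. *)
Lemma ideal_eval (E F : banach) (P : E -> F) (x : E) : A E F P ->
  rnorm (P x) <= N E F P * rnorm x ^+ n.
Proof.
move=> AP; have [phi bphi phiPx] := norming_functional (P x).
have [AQ] := ideal_lin_bound (rnorm_ge0 x) ler01 (lin_bound_line x) AP bphi.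
rewrite mul1r; apply: le_trans.
have [Apow Npow] := ideal_pow idealA.
have -> : phi \o P \o (fun z : Cb => (z : R[i]) *: x) =
    (fun z : Cb => (phi (P x) : R[i]) *: (z ^+ n : Cb)).
  apply/funext => z /=.
  rewrite (hom_poly_homogeneous _ _ (ideal_hom_poly idealA AP)).
  by rewrite (linear_funZ (proj1 bphi)); exact: mulrC.
by rewrite (ideal_normZ idealA _ Apow) Npow mulr1 phiPx.
Qed.

Lemma idealZ (E F : banach) (c : R[i]) (P : E -> F) :
  A E F P -> A E F (fun x => c *: P x).
Proof.
move=> AP; have := ideal_lin idealA c AP (ideal_zero idealA E F).
by congr (A E F _); apply/funext => x; rewrite addr0.
Qed.

Lemma idealB (E F : banach) (P Q : E -> F) :
  A E F P -> A E F Q -> A E F (fun x => P x - Q x).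
Proof.
move=> AP AQ; have := ideal_lin idealA (-1) AQ AP.
by congr (A E F _); apply/funext => x; rewrite scaleN1r addrC.
Qed.

Lemma ideal_norm0 (E F : banach) : N E F (fun _ : E => 0 : F) = 0.
Proof.
have := ideal_normZ idealA 0 (ideal_zero idealA E F).
by rewrite rnorm0 mul0r; under eq_fun do rewrite scaler0.
Qed.

Lemma ideal_sum (E F : banach) (I : Type) (r : seq I) (P : I -> E -> F) (M : R) :
  (forall i, A E F (P i) /\ N E F (P i) <= M) ->
  A E F (fun x => \sum_(i <- r) P i x) /\
  N E F (fun x => \sum_(i <- r) P i x) <= (size r)%:R * M.
Proof.
move=> AP; elim: r => [|i r [Ar Nr]].
  have -> : (fun x => \sum_(j <- [::]) P j x) = (fun=> 0).
    by apply/funext => x; rewrite big_nil.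
  by rewrite ideal_norm0 mul0r; split=> //; exact: (ideal_zero idealA).
have [APi NPi] := AP i.
have -> : (fun x => \sum_(j <- i :: r) P j x) =
    (fun x => P i x + \sum_(j <- r) P j x).
  by apply/funext => x; rewrite big_cons.
split.
  have := ideal_lin idealA 1 APi Ar.
  by under eq_fun do rewrite scale1r.
apply: (le_trans (ideal_normD idealA APi Ar)).
by rewrite /= -natr1 mulrDl mul1r addrC lerD.
Qed.

End NormedIdeals.

(** * Polarization and extraction of a coefficient by roots of unity *)

Section Polarization.
Variable R : realType.

Notation banach := (completeNormedModType R[i]).
Notation Cb := (R[i] : banach).

(** Induction on [k] with Pascal's rule. In the application [j] counts the arguments [a] and [k] the
    arguments [x + c *: a]. *)
Lemma pascal_expansion (V : lmodType R[i]) (c : R[i]) (G : nat -> nat -> V)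
    (n : nat) :
  (forall j k, (j + k < n)%N -> G j k.+1 = G j k + c *: G j.+1 k) ->
  forall k j, (j + k <= n)%N ->
  G j k = \sum_(i < k.+1) (c ^+ i *+ 'C(k, i)) *: G (j + i)%N 0%N.
Proof.
move=> GS; elim=> [|k IHk] j jk.
  by rewrite big_ord1 bin0 scale1r addn0.
rewrite GS; last by rewrite -addnS.
rewrite !IHk ?addSnnS// ?(leq_trans _ jk)// ?leq_add2l//.
rewrite [RHS]big_ord_recl.
under [X in _ = _ + X]eq_bigr => i _ do
  rewrite lift0 binS mulrnDr scalerDl addnS.
rewrite big_split addrA /=; congr (_ + _).
  rewrite [X in _ = _ + X]big_ord_recr /= (bin_small (ltnSn k)).
  rewrite mulr0n scale0r addr0 big_ord_recl.
  rewrite !bin0; congr (_ + _).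
  by apply: eq_bigr => i _; rewrite lift0 addnS.
rewrite scaler_sumr; apply: eq_bigr => i _.
by rewrite scalerA mulrnAr -exprS addSn.
Qed.

Lemma polar_binomial n (E F : banach) (phi : ('I_n -> E) -> F) (c : R[i])
    (x a : E) : multilinear phi -> symmetric_map phi ->
  phi (fun=> x + c *: a) = \sum_(k < n.+1)
    (c ^+ k *+ 'C(n, k)) *: phi (fun i => if (i < k)%N then a else x).
Proof.
move=> mphi sphi.
pose G j k := phi (fun i : 'I_n => if (i < j)%N then a else
  if (i < j + k)%N then x + c *: a else x).
have -> : phi (fun=> x + c *: a) = G 0 n.
  by congr phi; apply/funext => i; rewrite ltn_ord.
rewrite (@pascal_expansion _ c G n)//.
  apply: eq_bigr => k _; congr (_ *: phi _); apply/funext => i.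
  by rewrite add0n addn0; case: ltnP.
move=> j k jkn; have jn : (j < n)%N by exact: leq_ltn_trans (leq_addr _ _) jkn.
pose oj := Ordinal jn; pose ojk := Ordinal jkn.
pose v (i : 'I_n) := if (i < j)%N then a else
  if (i < (j + k).+1)%N then x + c *: a else x.
have := mphi v oj c a x; rewrite [c *: a + x]addrC [c *: _ + _]addrC.
(* Expanding slot [j] leaves a term with [x] there; exchanging slots [j] and [j + k] moves this [x]
   behind the block of [x + c *: a], which gives [G j k]. *)
rewrite -[X in _ = X + _](sphi (tperm oj ojk)).
have E1 : (fun i : 'I_n => if i == oj then x + c *: a else v i) = v.
  apply/funext => i; case: eqP => // ->.
  by rewrite /v /= ltnn ltnS leq_addr.
rewrite E1 [G j k.+1](_ : _ = phi v); last first.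
  by congr phi; apply/funext => i; rewrite /v addnS.
move->; congr (_ + c *: _); congr phi; apply/funext => i; rewrite /v.
  case: tpermP => [->|->|/eqP + /eqP]; rewrite -?val_eqE /=.
  - rewrite !ltnn; have := leq_addr k j; rewrite leq_eqVlt => /predU1P[<-|jk].
      by rewrite eqxx ltnn.
    by rewrite gtn_eqF// ltnNge ltnW//= ltnSn jk.
  - by rewrite eqxx ltnn ltnNge leq_addr.
  - by move=> /negbTE ij /negbTE ijk; rewrite ij ltnS [(i <= _)%N]leq_eqVlt ijk.
rewrite -val_eqE /= addSn [(i < j.+1)%N]ltnS [(i <= j)%N]leq_eqVlt.
by case: eqP.
Qed.

(** If [N] does not divide [m], the geometric sum times the nonzero [w ^+ m - 1] is
    [w ^+ (m * N) - 1 = 0]. *)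
Lemma sum_primitive_root (w : R[i]) N m : N.-primitive_root w ->
  \sum_(j < N) w ^+ (j * m) = if (N %| m)%N then N%:R else 0.
Proof.
move=> pw; case: ifPn => [|Nm].
  rewrite (prim_order_dvd pw) => /eqP wm.
  under eq_bigr => j _ do rewrite mulnC exprM wm expr1n.
  by rewrite sumr_const card_ord.
have wm1 : w ^+ m - 1 != 0 by rewrite subr_eq0 -(prim_order_dvd pw).
apply: (mulfI wm1); rewrite mulr0.
under eq_bigr => j _ do rewrite mulnC exprM.
by rewrite -subrX1 -exprM mulnC exprM (prim_expr_order pw) expr1n subrr.
Qed.

(** Over an algebraically closed field of characteristic 0, ['X^N - 1] has [N] distinct roots, and
    [N] distinct roots of unity include a primitive one. *)
Lemma primitive_root_exists N : (0 < N)%N -> exists w : R[i], N.-primitive_root w.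
Proof.
move=> N0; pose p : {poly R[i]} := 'X^N - 1.
have [r Dp] := closed_field_poly_normal p.
rewrite (monicP _) ?monicXnsubC // scale1r in Dp.
have rn1 : all N.-unity_root r by apply/allP=> z; rewrite -root_prod_XsubC -Dp.
have sz_r : (N < (size r).+1)%N.
  by rewrite -(size_prod_XsubC r id) -Dp size_XnsubC.
have [|z] := hasP (has_prim_root N0 rn1 _ sz_r); last by exists z.
by rewrite -separable_prod_XsubC -Dp separable_Xn_sub_1 // pnatr_eq0 -lt0n.
Qed.

Lemma rnorm_primitive_root (w : R[i]) N : N.-primitive_root w -> rnorm w = 1.
Proof.
move=> pw; have := prim_expr_order pw => /(congr1 (@rnorm R R[i])).
rewrite rnormX rnorm1 => /eqP.
by rewrite pexpr_eq1 ?rnorm_ge0 ?(prim_order_gt0 pw)// => /eqP.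
Qed.

(* Summing against [w ^+ (j * 2)] selects the coefficient of degree [n - 1],
   because [w] has order [n + 1] and [(n - 1) + 2 = n + 1]. *)
Lemma root_filter (V : lmodType R[i]) (w : R[i]) n (d : nat -> V) :
  (0 < n)%N -> n.+1.-primitive_root w ->
  \sum_(j < n.+1) w ^+ (j * 2) *: \sum_(k < n.+1) (w ^+ j) ^+ k *: d k =
  n.+1%:R *: d n.-1.
Proof.
move=> n0 pw.
under eq_bigr => j _ do rewrite scaler_sumr.
rewrite exchange_big /=.
under eq_bigr => k _.
  under eq_bigr => j _ do rewrite scalerA -exprM -exprD -mulnDr.
  rewrite -scaler_suml sum_primitive_root//.
  over.
have n1 : (n.-1 < n.+1)%N by rewrite prednK ?leqW.
rewrite (bigD1 (Ordinal n1))//= add2n prednK// dvdnn big1 ?addr0// => k.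
rewrite -val_eqE /= => kn1; rewrite ifN ?scale0r//.
apply/negP => /dvdnP[q]; have := ltn_ord k; case: q => [|[|q]]; rewrite ?mulSn.
- by [].
- by move: kn1; lia.
- by lia.
Qed.

Lemma hom_poly_polar n (E F : banach) (P : E -> F) :
  hom_poly n P -> polar_of P (polar P : ('I_n -> E) -> F).
Proof. by case=> _ Pphi; exact: xgetPex. Qed.

(** The factor [n.+1] is the number of roots of unity, and [n] is the binomial coefficient of degree
    [n - 1] in [a]. *)
Lemma poly_fix_filter n (E F : banach) (P : E -> F) (w : R[i]) (a x : E) :
  (0 < n)%N -> n.+1.-primitive_root w -> hom_poly n P ->
  \sum_(j < n.+1) w ^+ (j * 2) *: P (x + w ^+ j *: a) =
  (n.+1 * n)%:R *: poly_fix n n.-1 P a x.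
Proof.
move=> n0 pw /hom_poly_polar[mphi sphi Pphi].
under eq_bigr => j _.
  rewrite Pphi polar_binomial//.
  under eq_bigr => k _ do rewrite -mulr_natr -scalerA.
  over.
rewrite (@root_filter _ w n (fun k => 'C(n, k)%:R *:
  polar P (fun i : 'I_n => if (i < k)%N then a else x)))//.
by rewrite scalerA -natrM -subn1 bin_sub// bin1.
Qed.

Lemma poly_fix_linear n (E F : banach) (P : E -> F) (a : E) :
  (0 < n)%N -> hom_poly n P -> linear (poly_fix n n.-1 P a).
Proof.
case: n => // n _ /hom_poly_polar[mphi _ _].
have -> : poly_fix n.+1 n.+1.-1 P a =
    (fun x => polar P (fun j : 'I_n.+1 => if j == ord_max then x else a)).
  apply/funext => x; congr (polar P _); apply/funext => j.
  rewrite -val_eqE /=; have := ltn_ord j; rewrite ltnS leq_eqVlt.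
  by case: eqP => [->|_ /= ->]//; rewrite ltnn.
exact: mphi.
Qed.

Lemma poly_fixZ n (E F : banach) (P : E -> F) (c : R[i]) (a x : E) :
  (0 < n)%N -> hom_poly n P ->
  poly_fix n n.-1 P (c *: a) x = c ^+ n.-1 *: poly_fix n n.-1 P a x.
Proof.
move=> n0 /hom_poly_polar[mphi _ _].
rewrite /poly_fix -(multilinear_scale c _ mphi (leq_pred n)).
by congr (polar P _); apply/funext => i; case: ifP.
Qed.

(** By [poly_fix_filter] the map is a finite linear combination of translates of [P], from which it
    inherits continuity. *)
Lemma poly_fix_continuous n (E F : banach) (P : E -> F) (a : E) :
  (0 < n)%N -> hom_poly n P -> continuous_linear (poly_fix n n.-1 P a).
Proof.
move=> n0 hP; split; first exact: poly_fix_linear.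
have [w pw] := primitive_root_exists (ltn0Sn n).
have nn0 : (n.+1 * n)%:R != 0 :> R[i] by rewrite pnatr_eq0 muln_eq0 -lt0n n0.
have -> : poly_fix n n.-1 P a = (fun x => (n.+1 * n)%:R^-1 *:
    \sum_(j < n.+1) w ^+ (j * 2) *: P (x + w ^+ j *: a)).
  apply/funext => x; rewrite (poly_fix_filter a x n0 pw hP) scalerA.
  by rewrite mulVf// scale1r.
move=> x; apply: (cvgZ (cvg_cst _)).
apply: (cvg_big (@add_continuous F)) => j _; apply: (cvgZ (cvg_cst _)).
apply: (cvg_comp (fun z => z + w ^+ j *: a) P _ (proj1 hP (x + w ^+ j *: a))).
exact: (cvgD cvg_id (cvg_cst _)).
Qed.

End Polarization.

(** * Limits and the constant [e] *)

Section Limits.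
Variable R : realType.

(** This removes the slack from bounds first proved with a positive [d] added to a possibly zero
    norm. *)
Lemma le_right_limit (f : R -> R) (x : R) :
  {for 0, continuous f} -> (forall d, 0 < d -> x <= f d) -> x <= f 0.
Proof.
move=> cf xf; rewrite leNgt; apply/negP => fx.
have /cvgrPdist_lt/(_ (x - f 0)) := cf; rewrite subr_gt0 => /(_ fx).
move=> /nbhs_ballP[e /= e0 he].
have e2 : 0 < e / 2 by rewrite divr_gt0.
have /= fe := he (e / 2); have {}fe : `|f 0 - f (e / 2)| < x - f 0.
  by apply: fe; rewrite -ball_normE /= sub0r normrN gtr0_norm//; lra.
have := xf _ e2; have := ler_norm (f (e / 2) - f 0); rewrite distrC; lra.
Qed.

Lemma continuous_shift_exp (g : R) (m : nat) :
  continuous (fun d : R => (g + d) ^+ m).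
Proof.
move=> d; apply: (@continuous_comp _ _ _ (fun d => g + d) (fun x => x ^+ m)).
  exact: (cvgD (cvg_cst _) cvg_id).
exact: exprn_continuous.
Qed.

Lemma rnorm_complete (F : completeNormedModType R[i]) (u : nat -> F) :
  (forall e : R, 0 < e -> exists m, forall i j, (m <= i)%N -> (m <= j)%N ->
    rnorm (u i - u j) < e) ->
  exists l, forall e : R, 0 < e -> exists m, forall k, (m <= k)%N ->
    rnorm (u k - l) < e.
Proof.
move=> cu.
have /cvg_ex[/= l ul] : cvg (u @ \oo).
  apply: cauchy_cvg; apply/cauchyP => e e0.
  have er : e = (complex.Re e)%:C by apply/esym/RRe_real/gtr0_real.
  have [|m um] := cu (complex.Re e); first by rewrite -ltcR -er.
  exists (u m), m => // k /= mk.
  by rewrite -ball_normE /= normr_rnorm er ltcR um.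
exists l => e e0; move/cvgrPdist_lt: ul => /(_ e%:C).
rewrite ltcR => /(_ e0)[m _ um]; exists m => k mk.
by have := um k mk; rewrite /= normr_rnorm ltcR -rnormN opprB.
Qed.

(** For [m > 0] this is [(1 + 1/m)^m <= e] multiplied by [(m + 1) m^m]. For [m = 0] the choice
    [t = 1] keeps [t] positive and leaves [2 <= e]. *)
Lemma exp_bound (m : nat) : let t := (maxn m 1)%:R : R in
  (1 + t) ^+ m.+1 <= expR 1 * (m.+1%:R * t ^+ m).
Proof.
move=> /=; case: m => [|m].
  rewrite max0n expr1 expr0 !mulr1.
  by have := expR_ge1Dx (1 : R); lra.
rewrite (maxn_idPl _)//; set t : R := m.+1%:R.
have t0 : 0 < t by rewrite ltr0n.
have -> : m.+2%:R = 1 + t by rewrite addrC natr1.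
rewrite mulrCA exprS ler_wpM2l ?addr_ge0 ?(ltW t0)//.
have -> : expR 1 = expR (t^-1) ^+ m.+1 :> R.
  by rewrite -expRM_natr mulVf ?gt_eqF.
rewrite -exprMn lerXn2r ?nnegrE ?mulr_ge0 ?addr_ge0 ?expR_ge0 ?(ltW t0)//.
rewrite -ler_pdivrMr//; apply: le_trans (expR_ge1Dx _).
by rewrite mulrDl mul1r divff ?gt_eqF// addrC.
Qed.

End Limits.

(** * Operators whose multiples by powers of functionals lie in [An] *)

Section AssociatedIdeal.
Variables (R : realType) (n : nat) (An : map_class R) (Nn : class_norm R).
Arguments An : clear implicits.
Arguments Nn : clear implicits.
Hypotheses (n_gt0 : (0 < n)%N) (idealAn : normed_ideal n An Nn).

Notation banach := (completeNormedModType R[i]).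
Notation Cb := (R[i] : banach).

Definition mul_bound (E F : banach) (T : E -> F) (C : R) :=
  0 <= C /\ forall (E1 : banach) (gamma : E1 -> Cb) (U : E1 -> E),
    lin_bound 1 gamma -> lin_bound 1 U ->
    An E1 F (power_mul n.-1 gamma (T \o U)) /\
    Nn E1 F (power_mul n.-1 gamma (T \o U)) <= C.

Definition mul_class (E F : banach) : set (E -> F) :=
  [set T | continuous_linear T /\ exists C, mul_bound T C].

(** On [mul_class] the infimum is itself a bound ([mul_norm_bound]), hence the supremum of the norms
    of [gamma^(n-1) (T o U)] over contractions. *)
Definition mul_norm (E F : banach) (T : E -> F) : R :=
  inf [set C | mul_bound T C].

Lemma mul_norm_bound (E F : banach) (T : E -> F) :
  mul_class T -> mul_bound T (mul_norm T).
Proof.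
move=> [_ TC]; split=> [|E1 gamma U bg bU].
  by apply: lb_le_inf => // C [].
split; first by have [C [_ /(_ _ _ _ bg bU)[]]] := TC.
by apply: lb_le_inf => // C [_ /(_ _ _ _ bg bU)[]].
Qed.

Lemma mul_norm_le (E F : banach) (T : E -> F) (C : R) :
  mul_bound T C -> mul_norm T <= C.
Proof. by move=> TC; apply: ge_inf => //; exists 0 => D []. Qed.

Lemma mul_norm_ge0 (E F : banach) (T : E -> F) : mul_class T -> 0 <= mul_norm T.
Proof. by case/mul_norm_bound. Qed.

Lemma mul_bound_pos (E F E1 : banach) (T : E -> F) (C g u : R)
    (gamma : E1 -> Cb) (U : E1 -> E) :
  linear T -> mul_bound T C -> 0 < g -> 0 < u ->
  lin_bound g gamma -> lin_bound u U ->
  An E1 F (power_mul n.-1 gamma (T \o U)) /\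
  Nn E1 F (power_mul n.-1 gamma (T \o U)) <= C * g ^+ n.-1 * u.
Proof.
move=> linT [C0 TC] g0 u0 bg bU.
have unit_scale (V W : banach) (r : R) (f : V -> W) : 0 < r ->
    lin_bound r f -> lin_bound 1 (fun x => (r^-1)%:C *: f x).
  move=> r0 bf; have := lin_boundZ (r^-1)%:C bf.
  by rewrite rnormR ger0_norm ?invr_ge0 ?(ltW r0)// mulVf ?gt_eqF.
have [AQ NQ] := TC _ _ _ (unit_scale _ _ _ _ g0 bg) (unit_scale _ _ _ _ u0 bU).
have -> : power_mul n.-1 gamma (T \o U) = (fun x => (g ^+ n.-1 * u)%:C *:
    power_mul n.-1 (fun x => (g^-1)%:C *: gamma x)
      (T \o (fun x => (u^-1)%:C *: U x)) x).
  apply/funext => x; rewrite /power_mul /= (linear_funZ linT) !scalerA.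
  congr (_ *: _); rewrite [(g^-1)%:C *: gamma x]/(g^-1%:C * gamma x).
  rewrite exprMn -rmorphXn mulrA mulrAC -!rmorphM /= exprVn.
  by rewrite [X in X%:C](_ : _ = 1) ?mul1r//; field; rewrite expf_neq0 ?gt_eqF.
split; first exact: (idealZ idealAn).
rewrite (ideal_normZ idealAn)// rnormR ger0_norm; last first.
  by rewrite mulr_ge0 ?exprn_ge0 ?ltW.
by rewrite mulrC -mulrA ler_wpM2r// mulr_ge0 ?exprn_ge0 ?ltW.
Qed.

(* [g] or [u] may vanish, so rescale by [g + d] and [u + d] and let [d] tend
   to 0. *)
Lemma mul_bound_apply (E F E1 : banach) (T : E -> F) (C g u : R)
    (gamma : E1 -> Cb) (U : E1 -> E) :
  linear T -> mul_bound T C -> 0 <= g -> 0 <= u ->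
  lin_bound g gamma -> lin_bound u U ->
  An E1 F (power_mul n.-1 gamma (T \o U)) /\
  Nn E1 F (power_mul n.-1 gamma (T \o U)) <= C * g ^+ n.-1 * u.
Proof.
move=> linT TC g0 u0 bg bU.
have H (d : R) : 0 < d -> An E1 F (power_mul n.-1 gamma (T \o U)) /\
    Nn E1 F (power_mul n.-1 gamma (T \o U)) <= C * (g + d) ^+ n.-1 * (u + d).
  move=> d0; apply: mul_bound_pos => //; rewrite ?ltr_wpDl//.
    by apply: lin_bound_le bg; rewrite lerDl ltW.
  by apply: lin_bound_le bU; rewrite lerDl ltW.
split; first by have [] := H 1 ltr01.
have := @le_right_limit _ (fun d => C * (g + d) ^+ n.-1 * (u + d)).
rewrite !addr0; apply=> [|d /H[]//].
apply: cvgM; last exact: (cvgD (cvg_cst _) cvg_id).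
apply: cvgM; first exact: cvg_cst.
exact: continuous_shift_exp.
Qed.

Lemma mul_bound_lin (E F : banach) (c : R[i]) (T S : E -> F) (C D : R) :
  mul_bound T C -> mul_bound S D ->
  mul_bound (fun x => c *: T x + S x) (rnorm c * C + D).
Proof.
move=> [C0 TC] [D0 SD]; split=> [|E1 gamma U bg bU].
  by rewrite addr_ge0// mulr_ge0// rnorm_ge0.
have [AT NT] := TC _ _ _ bg bU; have [AS NS] := SD _ _ _ bg bU.
have -> : power_mul n.-1 gamma ((fun x => c *: T x + S x) \o U) = (fun x =>
    c *: power_mul n.-1 gamma (T \o U) x + power_mul n.-1 gamma (S \o U) x).
  by apply/funext => x; rewrite /power_mul /= scalerDr !scalerA mulrC.
split; first exact: (ideal_lin idealAn).
have AcT := idealZ idealAn c AT.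
apply: (le_trans (ideal_normD idealAn AcT AS)); rewrite lerD//.
by rewrite (ideal_normZ idealAn)// ler_wpM2l ?rnorm_ge0.
Qed.

Lemma mul_bound0 (E F : banach) : mul_bound (fun _ : E => 0 : F) 0.
Proof.
split=> // E1 gamma U bg bU.
have -> : power_mul n.-1 gamma ((fun _ : E => 0 : F) \o U) = (fun=> 0).
  by apply/funext => x; rewrite /power_mul /= scaler0.
by rewrite (ideal_norm0 idealAn); split=> //; exact: (ideal_zero idealAn).
Qed.

Lemma mul_boundZ (E F : banach) (c : R[i]) (T : E -> F) (C : R) :
  mul_bound T C -> mul_bound (fun x => c *: T x) (rnorm c * C).
Proof.
move=> TC; have := mul_bound_lin c TC (mul_bound0 E F).
by rewrite addr0; congr mul_bound; apply/funext => x; rewrite addr0.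
Qed.

Lemma mul_boundD (E F : banach) (T S : E -> F) (C D : R) :
  mul_bound T C -> mul_bound S D -> mul_bound (fun x => T x + S x) (C + D).
Proof.
move=> TC SD; have := mul_bound_lin 1 TC SD.
rewrite rnorm1 mul1r; congr mul_bound.
by apply/funext => x; rewrite scale1r.
Qed.

(** [V] is absorbed into the auxiliary operator as [V \o U], while [S] commutes with the scalar
    factor and is handled by the ideal property of [An]. *)
Lemma mul_bound_comp (E1 E F F1 : banach) (V : E1 -> E) (T : E -> F)
    (S : F -> F1) (v C s : R) : 0 <= v -> 0 <= s -> linear T ->
  lin_bound v V -> mul_bound T C -> lin_bound s S ->
  mul_bound (S \o T \o V) (s * C * v).
Proof.
move=> v0 s0 linT bV TC bS; have C0 := proj1 TC.
split=> [|E2 gamma U bg bU]; first by rewrite !mulr_ge0.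
have [AQ NQ] := mul_bound_apply linT TC ler01 v0 bg
  (eq_ind _ (fun r => lin_bound r _) (lin_bound_comp v0 bU bV) _ (mulr1 v)).
have [AS NS] := ideal_lin_bound idealAn ler01 s0 (lin_bound_id E2) AQ bS.
have -> : power_mul n.-1 gamma (S \o T \o V \o U) =
    S \o power_mul n.-1 gamma (T \o (V \o U)) \o id.
  by apply/funext => x; rewrite /power_mul /= (linear_funZ (proj1 bS)).
split=> //; apply: (le_trans NS).
move: NQ; rewrite !expr1n !mulr1 => NQ.
by rewrite -mulrA ler_wpM2l.
Qed.

Lemma continuous_linear_lin (E F : banach) (c : R[i]) (T S : E -> F) :
  continuous_linear T -> continuous_linear S ->
  continuous_linear (fun x => c *: T x + S x).
Proof.
move=> /continuous_lin_bound[_ bT] /continuous_lin_bound[_ bS].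
exact: lin_bound_continuous (lin_boundD (lin_boundZ c bT) bS).
Qed.

Lemma continuous_linear_comp (E F G : banach) (T : E -> F) (S : F -> G) :
  continuous_linear T -> continuous_linear S -> continuous_linear (S \o T).
Proof.
move=> /continuous_lin_bound[_ bT] /continuous_lin_bound[S0 bS].
exact: lin_bound_continuous (lin_bound_comp S0 bT bS).
Qed.

(** For [x] nonzero, take [U = id] and [gamma] not vanishing at [x]: from [gamma(x)^(n-1) T x = 0]
    follows [T x = 0]. *)
Lemma mul_norm_eq0 (E F : banach) (T : E -> F) :
  mul_class T -> mul_norm T = 0 -> T = (fun=> 0).
Proof.
move=> AT NT; apply/funext => x; have [linT _] := proj1 AT.
have [->|x0] := eqVneq x 0; first exact: linear_fun0.
have [gamma bg gx] := dual_separates x0.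
have [_ /(_ _ _ _ bg (lin_bound_id E))] := mul_norm_bound AT.
rewrite NT => -[AQ NQ].
have {}NQ : Nn E F (power_mul n.-1 gamma (T \o id)) = 0.
  by apply/le_anti; rewrite NQ (ideal_norm_ge0 idealAn).
have := ideal_norm_eq0 idealAn AQ NQ => /(congr1 (fun f => f x)).
rewrite /power_mul /= => /eqP; rewrite scaler_eq0 => /predU1P[|/eqP//].
by move=> /eqP; rewrite expf_eq0 (negbTE gx) andbF.
Qed.

Lemma mul_class_lin (E F : banach) (c : R[i]) (T S : E -> F) :
  mul_class T -> mul_class S -> mul_class (fun x => c *: T x + S x).
Proof.
move=> [cT [C TC]] [cS [D SD]]; split; first exact: continuous_linear_lin.
by exists (rnorm c * C + D); exact: mul_bound_lin.
Qed.

Lemma mul_class0 (E F : banach) : mul_class (fun _ : E => 0 : F).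
Proof.
split; last by exists 0; exact: mul_bound0.
apply: (@lin_bound_continuous _ _ _ 0); split=> [c x y|x].
  by rewrite scaler0 addr0.
by rewrite rnorm0 mul0r.
Qed.

Lemma mul_classZ (E F : banach) (c : R[i]) (T : E -> F) :
  mul_class T -> mul_class (fun x => c *: T x).
Proof.
move=> AT; have := mul_class_lin c AT (mul_class0 E F).
by congr mul_class; apply/funext => x; rewrite addr0.
Qed.

Lemma mul_normZ (E F : banach) (c : R[i]) (T : E -> F) : mul_class T ->
  mul_norm (fun x => c *: T x) = rnorm c * mul_norm T.
Proof.
move=> AT; have bT := mul_norm_bound AT; have AcT := mul_classZ c AT.
apply/le_anti; rewrite (mul_norm_le (mul_boundZ c bT)) /=.
have [->|c0] := eqVneq c 0.
  by rewrite rnorm0 mul0r; exact/mul_norm_ge0/mul_classZ.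
have rc0 : 0 < rnorm c by rewrite lt_def rnorm_eq0 c0 rnorm_ge0.
(* The reverse inequality is the first one for the scalar [c^-1] and the operator [c *: T]. *)
rewrite -ler_pdivlMl//.
have := mul_norm_le (mul_boundZ c^-1 (mul_norm_bound AcT)).
under [X in mul_norm X <= _]eq_fun do rewrite scalerA mulVf// scale1r.
move/le_trans; apply; rewrite ler_wpM2r ?mul_norm_ge0//.
rewrite -[leRHS]mul1r ler_pdivlMr//.
by rewrite -rnormM mulVf// rnorm1.
Qed.

Lemma poly_fix_mul_bound (E F : banach) (P : E -> F) (a : E) : An E F P ->
  mul_bound (poly_fix n n.-1 P a) (expR 1 * Nn E F P * rnorm a ^+ n.-1).
Proof.
move=> AP; have hP := ideal_hom_poly idealAn AP.
have P0 := ideal_norm_ge0 idealAn AP.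
split=> [|E1 gamma U bg bU].
  by rewrite !mulr_ge0 ?expR_ge0 ?exprn_ge0 ?rnorm_ge0.
have [w pw] := primitive_root_exists R (ltn0Sn n).
pose t : R := (maxn n.-1 1)%:R.
have t0 : 0 < t by rewrite ltr0n leq_max orbT.
have H (d : R) : 0 < d ->
    An E1 F (power_mul n.-1 gamma (poly_fix n n.-1 P a \o U)) /\
    Nn E1 F (power_mul n.-1 gamma (poly_fix n n.-1 P a \o U)) <=
    expR 1 * Nn E F P * (rnorm a + d) ^+ n.-1.
  move=> d0; pose r := rnorm a + d.
  have r0 : 0 < r by rewrite ltr_wpDl ?rnorm_ge0.
  (* The vector [b] has norm at most [t]; the slack [d] keeps [r] positive even when [a = 0]. *)
  pose b := (t / r)%:C *: a.
  (* [V j] is linear, so [P \o V j] stays in [An]; degree [n - 1] in the second summand produces the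
     factor [gamma^(n-1)]. *)
  pose V j x := U x + (gamma x : R[i]) *: (w ^+ j *: b).
  have bV j : lin_bound (1 + t) (V j).
    apply: lin_bound_le (lin_boundD bU (lin_bound_rank1 (w ^+ j *: b) bg)).
    rewrite lerD2l mul1r !rnormZ rnormX (rnorm_primitive_root pw) expr1n mul1r.
    rewrite rnormR ger0_norm ?divr_ge0 ?(ltW t0) ?(ltW r0)// mulrAC ler_pdivrMr//.
    by rewrite ler_wpM2l ?ltW// /r ltrDl.
  have t1 : 0 <= 1 + t by rewrite addr_ge0 ?ltW.
  have APV j : An E1 F (fun x => w ^+ (j * 2) *: P (V j x)) /\
      Nn E1 F (fun x => w ^+ (j * 2) *: P (V j x)) <= Nn E F P * (1 + t) ^+ n.
    have [AV NV] := ideal_precomp idealAn t1 (bV j) AP.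
    split; first exact: (idealZ idealAn _ AV).
    rewrite (ideal_normZ idealAn _ AV) rnormX (rnorm_primitive_root pw).
    by rewrite expr1n mul1r.
  have [AQ NQ] := ideal_sum idealAn (index_enum 'I_n.+1)
    (fun j : 'I_n.+1 => APV j).
  (* [k] collects the factor of [poly_fix_filter] and the rescaling of [a] to [b]. *)
  pose k : R := n.+1%:R * n%:R * (t / r) ^+ n.-1.
  have k0 : 0 < k.
    have tr0 : 0 < t / r by rewrite divr_gt0.
    by apply: mulr_gt0; [apply: mulr_gt0; rewrite ltr0n|exact: exprn_gt0].
  have -> : power_mul n.-1 gamma (poly_fix n n.-1 P a \o U) =
      (fun x => (k^-1)%:C *: \sum_(j < n.+1) w ^+ (j * 2) *: P (V j x)).
    apply/funext => x; rewrite /V /b.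
    under eq_bigr => j _ do rewrite scalerA mulrC -scalerA.
    rewrite (poly_fix_filter _ _ n_gt0 pw hP) !poly_fixZ// /power_mul /=.
    have kE : (k^-1)%:C * (n.+1 * n)%:R * (t / r)%:C ^+ n.-1 = 1 :> R[i].
      rewrite -rmorphXn -(rmorph_nat (real_complex R)) -!rmorphM natrM.
      by rewrite -mulrA mulVf ?gt_eqF.
    by rewrite !scalerA mulrCA kE mulr1.
  split; first exact: (idealZ idealAn _ AQ).
  rewrite (ideal_normZ idealAn _ AQ) rnormR ger0_norm ?invr_ge0 ?(ltW k0)//.
  rewrite ler_pdivrMl//; apply: (le_trans NQ).
  (* The [n.+1] summands cancel the same factor of [k], leaving [(1 + t)^n / (n t^(n-1)) <= e] times
     [r^(n-1)]. *)
  rewrite [size _](_ : _ = n.+1); last by rewrite -[RHS]card_ord cardE enumT.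
  have := exp_bound R n.-1; rewrite prednK// -/t => /= ebound.
  rewrite /k -!mulrA ler_wpM2l// [leRHS](_ : _ =
    Nn E F P * (expR 1 * (n%:R * t ^+ n.-1))); first by rewrite ler_wpM2l.
  rewrite expr_div_n -/r; field.
  by rewrite expf_neq0 ?gt_eqF.
split; first by have [] := H 1 ltr01.
have := @le_right_limit _ (fun d => expR 1 * Nn E F P * (rnorm a + d) ^+ n.-1).
rewrite !addr0; apply=> [|d /H[]//].
apply: cvgM; first exact: cvg_cst.
exact: continuous_shift_exp.
Qed.

End AssociatedIdeal.

(** * Normalization, compatibility, completeness and uniqueness *)

Section AssociatedBanachIdeal.
Variables (R : realType) (n : nat) (An : map_class R) (Nn : class_norm R).
Arguments An : clear implicits.
Arguments Nn : clear implicits.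
Hypotheses (n_gt0 : (0 < n)%N) (idealAn : normed_ideal n An Nn).

Notation banach := (completeNormedModType R[i]).
Notation Cb := (R[i] : banach).

Let A : map_class R := mul_class n An Nn.
Let M : class_norm R := mul_norm n An Nn.
Let kappa : R := M (@id Cb).
Let N : class_norm R := fun E F T => M T / kappa.
Arguments A : clear implicits.
Arguments M : clear implicits.
Arguments N : clear implicits.

(** For [P = z^n], the map [P_{1^(n-1)}] is linear on the scalars with value [P 1 = 1] at 1, hence
    is the identity. *)
Lemma mul_bound_idC : mul_bound n An Nn (@id Cb) (expR 1).
Proof.
have [APow NPow] := ideal_pow idealAn.
have hP := ideal_hom_poly idealAn APow.
have := poly_fix_mul_bound n_gt0 idealAn (1 : R[i]) APow.
rewrite NPow rnorm1 expr1n !mulr1; congr mul_bound; apply/funext => x.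
have linL := poly_fix_linear (1 : R[i]) n_gt0 hP.
have [_ _ Ppow] := hom_poly_polar hP.
have -> : x = (x : R[i]) *: (1 : Cb) by exact: (esym (mulr1 x)).
rewrite (linear_funZ linL); congr (_ *: _).
rewrite /poly_fix (_ : (fun i : 'I_n => _) = (fun=> 1)).
  by rewrite -Ppow expr1n.
by apply/funext => i; rewrite if_same.
Qed.

Lemma mul_class_idC : A Cb Cb id.
Proof.
split; first exact: lin_bound_continuous (lin_bound_id _).
by exists (expR 1); exact: mul_bound_idC.
Qed.

Lemma kappa_le : kappa <= expR 1.
Proof. exact/mul_norm_le/mul_bound_idC. Qed.

(** Taking [gamma] and [U] to be the identity gives [z^n], of norm 1. *)
Lemma kappa_ge1 : 1 <= kappa.
Proof.
have [_ /(_ _ _ _ (lin_bound_id _) (lin_bound_id _))[_]] :=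
  mul_norm_bound mul_class_idC.
have [APow NPow] := ideal_pow idealAn.
congr (_ <= _); rewrite -NPow; congr (Nn Cb Cb _).
by apply/funext => z; rewrite -[in RHS](prednK n_gt0) exprSr.
Qed.

Let kappa_gt0 : 0 < kappa.
Proof. exact: lt_le_trans kappa_ge1. Qed.

Lemma mul_norm_normalized (E F : banach) (T : E -> F) : M E F T = kappa * N E F T.
Proof. by rewrite /N mulrC divfK ?gt_eqF. Qed.

Lemma mul_class_normed_ideal : normed_ideal 1 A N.
Proof.
split.
- by move=> E F P [cP _]; exact/hom_poly1.
- exact: mul_class0.
- by move=> E F c P Q; exact: mul_class_lin.
- by move=> E F P AP; rewrite divr_ge0 ?(ltW kappa_gt0)// mul_norm_ge0.
- move=> E F P AP /eqP; rewrite mulf_eq0 invr_eq0 [kappa == 0]gt_eqF// orbF.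
  by move=> /eqP; exact: mul_norm_eq0.
- by move=> E F c P AP; rewrite /N [M _ _ _]mul_normZ// mulrA.
- move=> E F P Q AP AQ; rewrite -mulrDl ler_wpM2r ?invr_ge0 ?(ltW kappa_gt0)//.
  by apply: mul_norm_le; apply: mul_boundD => //; exact: mul_norm_bound.
- move=> E1 E F F1 T P S cT AP cS.
  have [T0 bT] := continuous_lin_bound cT.
  have [S0 bS] := continuous_lin_bound cS.
  have linP := proj1 (proj1 AP).
  have bSPT := mul_bound_comp idealAn T0 S0 linP bT (mul_norm_bound AP) bS.
  split.
    split; last by eexists; exact: bSPT.
    exact: continuous_linear_comp cT (continuous_linear_comp (proj1 AP) cS).
  rewrite expr1 /N mulrA mulrAC ler_wpM2r ?invr_ge0 ?(ltW kappa_gt0)//.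
  exact: mul_norm_le.
- split; first exact: mul_class_idC.
  by rewrite /N divff// gt_eqF.
Qed.

(** The constant [e] survives the division by [kappa] because [kappa >= 1]; the second constant
    undoes that division. *)
Lemma mul_class_compatible : compatible_with_constants n An Nn A N (expR 1) kappa.
Proof.
move=> E F; split=> [P a AP|T gamma AT /continuous_lin_bound[g0 bg]].
  have hP := ideal_hom_poly idealAn AP.
  have bPa := poly_fix_mul_bound n_gt0 idealAn a AP.
  split.
    by split; [exact: poly_fix_continuous|eexists; exact: bPa].
  rewrite ler_pdivrMr//; apply: (le_trans (mul_norm_le bPa)).
  rewrite ler_peMr ?kappa_ge1//.
  by rewrite !mulr_ge0 ?expR_ge0 ?exprn_ge0 ?rnorm_ge0 ?(ideal_norm_ge0 idealAn AP).
have := mul_bound_apply idealAn (proj1 (proj1 AT)) (mul_norm_bound AT) g0 ler01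
  bg (lin_bound_id E).
by rewrite [mul_norm _ _ _ _]mul_norm_normalized mulr1 mulrAC.
Qed.

Lemma mul_norm_eval (E F : banach) (T : E -> F) (x : E) : A E F T ->
  rnorm (T x) <= M E F T * rnorm x.
Proof.
move=> AT; apply: (le_trans (ideal_eval mul_class_normed_ideal x AT)).
rewrite expr1 ler_wpM2r ?rnorm_ge0// ler_pdivrMr// ler_peMr ?kappa_ge1//.
exact: mul_norm_ge0.
Qed.

(** The limit [T] is built pointwise. For each fixed [gamma] and [U], completeness of [An] gives a
    limit of [gamma^(n-1) (u k o U)], identified through its values; uniformity in [gamma] and [U]
    gives convergence in [N]. *)
Lemma mul_class_complete : complete_class An Nn -> complete_class A N.
Proof.
move=> complAn E F u Au cauchy_u.
have {}cauchy_u (e : R) : 0 < e -> exists m, forall i j, (m <= i)%N ->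
    (m <= j)%N -> mul_bound n An Nn (fun x => u i x - u j x) e /\
    forall x, rnorm (u i x - u j x) <= e * rnorm x.
  move=> e0; have [|m um] := cauchy_u (e / kappa); first by rewrite divr_gt0.
  exists m => i j mi mj; have := um i j mi mj.
  rewrite ltr_pM2r ?invr_gt0// => /ltW Me.
  have Aij : A E F (fun x => u i x - u j x).
    exact: (idealB mul_class_normed_ideal).
  split=> [|x].
    have [M0 bM] := mul_norm_bound Aij.
    split=> [|E1 gamma U bg bU]; first exact: le_trans Me.
    by have [? h] := bM _ _ _ bg bU; split=> //; exact: le_trans h Me.
  by apply: (le_trans (mul_norm_eval x Aij)); rewrite ler_wpM2r ?rnorm_ge0.
have lim_ex x : exists l, forall e : R, 0 < e -> exists m, forall k,
    (m <= k)%N -> rnorm (u k x - l) < e.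
  apply: rnorm_complete => e e0.
  have d0 : 0 < e / (rnorm x + 1) by rewrite divr_gt0// ltr_wpDl ?rnorm_ge0.
  have [m um] := cauchy_u _ d0; exists m => i j mi mj.
  apply: (le_lt_trans (proj2 (um i j mi mj) x)).
  rewrite -mulrA gtr_pMr// mulrC ltr_pdivrMr ?ltr_wpDl ?rnorm_ge0//.
  by rewrite mul1r ltrDl.
have [T uT] := choice lim_ex.
have uniq_lim (l l' : F) (v : nat -> F) :
    (forall e : R, 0 < e -> exists m, forall k, (m <= k)%N ->
      rnorm (v k - l) < e) ->
    (forall e : R, 0 < e -> exists m, forall k, (m <= k)%N ->
      rnorm (v k - l') < e) ->
    l = l'.
  move=> vl vl'; apply/eqP; rewrite -subr_eq0 -rnorm_eq0; apply/eqP/le_anti.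
  rewrite rnorm_ge0 andbT; apply/ler_addgt0Pr => e e0; rewrite add0r.
  have e2 : 0 < e / 2 by rewrite divr_gt0.
  have [m1 h1] := vl _ e2; have [m2 h2] := vl' _ e2.
  have := h1 _ (leq_maxl m1 m2); have := h2 _ (leq_maxr m1 m2).
  set k := maxn m1 m2; have -> : l - l' = (v k - l') - (v k - l).
    by rewrite opprB [RHS]addrC addrA subrK.
  by have := rnormD (v k - l') (- (v k - l)); rewrite rnormN; lra.
have linu k : linear (u k) by have [[]] := Au k.
have bound_lim (e : R) : 0 < e -> exists m, forall k, (m <= k)%N ->
    forall x, rnorm (u k x - T x) <= e * rnorm x.
  move=> e0; have [m um] := cauchy_u e e0; exists m => k mk x.
  apply/ler_addgt0Pr => d d0; have [m' um'] := uT x d d0.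
  have := um' _ (leq_maxr m m'); have := proj2 (um k _ mk (leq_maxl m m')) x.
  set j := maxn m m'; have -> : u k x - T x = (u k x - u j x) + (u j x - T x).
    by rewrite addrA subrK.
  by have := rnormD (u k x - u j x) (u j x - T x); lra.
have linT : linear T.
  move=> c x y; apply: (uniq_lim _ _ (fun k => u k (c *: x + y))); first exact: uT.
  move=> e e0; pose K := rnorm c * rnorm x + rnorm y + 1.
  have K0 : 0 < K by rewrite ltr_wpDl// addr_ge0 ?mulr_ge0 ?rnorm_ge0.
  have [|m um] := bound_lim (e / K); first by rewrite divr_gt0.
  exists m => k mk; rewrite (linu k).
  have -> : c *: u k x + u k y - (c *: T x + T y) =
      c *: (u k x - T x) + (u k y - T y).
    by rewrite scalerBr opprD addrACA.
  apply: (le_lt_trans (rnormD _ _)); rewrite rnormZ.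
  have h1 := um k mk x; have h2 := um k mk y.
  have := ler_wpM2l (rnorm_ge0 c) h1.
  have : e = e / K * K by rewrite divfK// gt_eqF.
  have : 0 < e / K by rewrite divr_gt0.
  rewrite {3}/K; nra.
have cT : continuous_linear T.
  have [m um] := bound_lim 1 ltr01.
  have [_ bu] := continuous_lin_bound (proj1 (Au m)).
  apply: (@lin_bound_continuous _ _ _ (unit_ball_norm (u m) + 1)); split=> // x.
  have := um m (leqnn m) x; have := proj2 bu x.
  have -> : T x = u m x - (u m x - T x) by rewrite subKr.
  by rewrite subKr; have := rnormD (u m x) (- (u m x - T x)); rewrite rnormN; lra.
have mul_lim (e : R) : 0 < e -> exists m, forall k, (m <= k)%N ->
    mul_bound n An Nn (fun x => u k x - T x) e.
  move=> e0; have [m um] := cauchy_u e e0; exists m => k mk.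
  split=> [|E1 gamma U bg bU]; first exact: ltW.
  pose v j := power_mul n.-1 gamma (u j \o U).
  have v_sub i (S : E -> F) : power_mul n.-1 gamma ((fun x => u i x - S x) \o U) =
      (fun x => v i x - power_mul n.-1 gamma (S \o U) x).
    by apply/funext => x; rewrite /v /power_mul /= scalerBr.
  have Av j : An E1 F (v j).
    by have [_ /(_ _ _ _ bg bU)[]] := mul_norm_bound (Au j).
  have [Q AQ vQ] : exists2 Q, An E1 F Q &
      (Nn E1 F (fun x => v k x - Q x) @[k --> \oo] --> (0 : R)).
    apply: complAn => // d d0.
    have d2 : 0 < d / 2 by rewrite divr_gt0.
    have [m' um'] := cauchy_u _ d2; exists m' => i j mi mj.
    have [[_ /(_ _ _ _ bg bU)[_ h]] _] := um' i j mi mj.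
    by move: h; rewrite (v_sub i (u j)) => h; apply: (le_lt_trans h); lra.
  have {}vQ (d : R) : 0 < d -> exists m', forall k, (m' <= k)%N ->
      Nn E1 F (fun x => v k x - Q x) < d.
    move=> d0; move/cvgrPdist_lt: vQ => /(_ d d0)[m' _ h]; exists m' => j mj.
    have := h j mj; rewrite /= sub0r normrN; apply: le_lt_trans.
    exact: ler_norm.
  have AvQ j : An E1 F (fun x => v j x - Q x) by exact: (idealB idealAn).
  (* By [ideal_eval], convergence in [Nn] implies pointwise convergence, so both maps are the
     pointwise limit of [v]. *)
  have QE : Q = power_mul n.-1 gamma (T \o U).
    apply/funext => x; apply: (uniq_lim _ _ (fun k => v k x)) => d d0.
      have K0 : 0 < rnorm x ^+ n + 1 by rewrite ltr_wpDl ?exprn_ge0 ?rnorm_ge0.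
      have [|m' h] := vQ (d / (rnorm x ^+ n + 1)); first by rewrite divr_gt0.
      exists m' => j mj; have := ideal_eval idealAn x (AvQ j).
      move/le_lt_trans; apply; have := h j mj.
      have := ideal_norm_ge0 idealAn (AvQ j); rewrite ltr_pdivlMr//.
      by rewrite mulrDr mulr1; lra.
    pose g := rnorm (gamma x ^+ n.-1 : R[i]).
    have g0 : 0 <= g by exact: rnorm_ge0.
    have K0 : 0 < g + 1 by rewrite ltr_wpDl.
    have [|m' h] := uT (U x) (d / (g + 1)); first by rewrite divr_gt0.
    exists m' => j mj; rewrite /v /power_mul /= -scalerBr rnormZ -/g.
    have := h j mj; have := rnorm_ge0 (u j (U x) - T (U x)).
    by rewrite ltr_pdivlMr// mulrDr mulr1 mulrC; lra.
  rewrite (v_sub k T) -QE; split=> //.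
  (* The index [m'] depends on [gamma] and [U] but only serves to compare with a late [v j]; the
     threshold [m] for [k] does not. *)
  apply/ler_addgt0Pr => d d0; have [m' h] := vQ d d0.
  have := h _ (leq_maxr m m').
  have [[_ /(_ _ _ _ bg bU)[Akj Nkj]] _] := um k _ mk (leq_maxl m m').
  move: Akj Nkj; set j := maxn m m'; rewrite (v_sub k (u j)) => Akj Nkj Nj.
  have -> : (fun x => v k x - Q x) = (fun x => (v k x - v j x) + (v j x - Q x)).
    by apply/funext => x; rewrite addrA subrK.
  by have := ideal_normD idealAn Akj (AvQ j); lra.
have AT : A E F T.
  split=> //; have [m um] := mul_lim 1 ltr01.
  (* [T] is written as [- (u m - T) + u m]. *)
  eexists; have := mul_bound_lin idealAn (-1) (um m (leqnn m))
    (mul_norm_bound (Au m)).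
  congr mul_bound; apply/funext => x.
  by rewrite scaleN1r opprB subrK.
exists T => //; apply/cvgrPdist_le => e e0.
have [|m um] := mul_lim (e * kappa); first by rewrite mulr_gt0.
exists m => // k /= mk; rewrite sub0r normrN ger0_norm.
  by rewrite ler_pdivrMr//; apply: mul_norm_le; exact: um.
apply: (ideal_norm_ge0 mul_class_normed_ideal).
exact: (idealB mul_class_normed_ideal).
Qed.

(** One inclusion applies the second compatibility condition to every [T o U]. For the other,
    [P_{b^(n-1)}] lies in [A'] for [P = phi^(n-1) T], and [T] differs from [n P_{b^(n-1)}] by an
    operator vanishing on the kernel of [phi]. *)
Lemma compatible_ideal_unique (A' : map_class R) (N' : class_norm R) :
  normed_ideal 1 A' N' -> compatible n An Nn A' N' ->
  forall (E F : banach) (T : E -> F), A' E F T <-> A E F T.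
Proof.
move=> idA' [cA [cB [cA0 cB0 compat]]] E F T; split=> AT.
  have cT : continuous_linear T by exact/hom_poly1/(ideal_hom_poly idA').
  split=> //; exists (cB * N' E F T).
  have N0 := ideal_norm_ge0 idA' AT.
  split=> [|E1 gamma U bg bU]; first by rewrite mulr_ge0// ltW.
  have [ATU NTU] := ideal_precomp idA' ler01 bU AT.
  have [_ /(_ _ gamma ATU (lin_bound_continuous bg))[AQ NQ]] := compat E1 F.
  split=> //; apply: (le_trans NQ).
  have [g0 _] := continuous_lin_bound (lin_bound_continuous bg).
  have g1 := unit_ball_norm_le ler01 (proj2 bg).
  have g1n : unit_ball_norm gamma ^+ n.-1 <= 1 by rewrite exprn_ile1.
  rewrite expr1n mulr1 in NTU.
  rewrite -mulrA ler_wpM2l ?(ltW cB0)//.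
  apply: le_trans NTU; rewrite -[leRHS]mul1r ler_wpM2r//.
  exact: (ideal_norm_ge0 idA').
have [linT _] := proj1 AT.
(* The zero space carries no [phi] with [phi b = 1] and is treated apart. *)
have [[a a0]|noa] := pselect (exists a : E, a != 0); last first.
  rewrite (_ : T = fun=> 0); first exact: (ideal_zero idA').
  apply/funext => x; have [->|x0] := eqVneq x 0; first exact: linear_fun0.
  by case: noa; exists x.
have [phi bphi phia0] := dual_separates a0.
pose b := (phi a : R[i])^-1 *: a.
have phib : phi b = 1.
  by rewrite (linear_funZ (proj1 bphi)); exact: mulVf.
pose P := power_mul n.-1 phi T.
have AP : An E F P.
  have [_ /(_ T phi AT (lin_bound_continuous bphi))[]] :=
    mul_class_compatible E F; exact.
have hP := ideal_hom_poly idealAn AP.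
pose L := poly_fix n n.-1 P b.
have AL : A' E F L by have [/(_ P b AP)[]] := compat E F.
have linL : linear L by exact: poly_fix_linear.
have LE y : phi y = 0 -> n%:R *: L y = T y.
  move=> phiy; have [w pw] := primitive_root_exists R (ltn0Sn n).
  have n1 : n.+1%:R != 0 :> R[i] by rewrite pnatr_eq0.
  have sum_w : \sum_(j < n.+1) w ^+ j = 0.
    have := sum_primitive_root 1 pw; rewrite dvdn1 eqSS gtn_eqF// => s0.
    by rewrite -[RHS]s0; apply: eq_bigr => j _; rewrite muln1.
  apply: (scalerI n1); rewrite scalerA -natrM -(poly_fix_filter b y n_gt0 pw hP).
  rewrite /P /power_mul.
  (* As [phi (y + w^j b) = w^j], each summand is [w^(j(n+1)) (T y + w^j T b) = T y + w^j T b], and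
     the terms in [T b] sum to zero. *)
  under eq_bigr => j _.
    rewrite (linear_funD linT) (linear_funZ linT) (linear_funD (proj1 bphi)).
    rewrite (linear_funZ (proj1 bphi)) phib phiy add0r.
    rewrite [w ^+ j *: (1 : Cb)](mulr1 (w ^+ j)) scalerA -exprM -exprD -mulnDr.
    rewrite add2n prednK// mulnC exprM (prim_expr_order pw) expr1n scale1r.
    over.
  rewrite big_split /= -scaler_suml.
  rewrite sum_w scale0r addr0.
  by rewrite sumr_const card_ord scaler_nat.
pose r := T b - n%:R *: L b.
have Arank1 : A' E F (fun x => (phi x : R[i]) *: r).
  (* A rank-one operator factors through the identity of the scalars, which is [z^1]. *)
  have [Aid _] := ideal_pow idA'.
  by have [] := ideal_lin_bound idA' ler01 (rnorm_ge0 r) bphi Aid (lin_bound_line r).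
have := ideal_lin idA' n%:R AL Arank1.
congr (A' E F _); apply/funext => x; rewrite /r.
(* The vector [x - phi x *: b] lies in the kernel of [phi]. *)
have := LE (x - phi x *: b).
rewrite (linear_funB (proj1 bphi)) (linear_funZ (proj1 bphi)) phib.
rewrite [_ *: (1 : Cb)](mulr1 (phi x)) subrr => /(_ erefl).
rewrite (linear_funB linL) (linear_funZ linL) (linear_funB linT) (linear_funZ linT).
move=> e; rewrite -[RHS](subrK ((phi x : R[i]) *: T b)) -e !scalerBr !scalerA.
by rewrite mulrC addrA addrAC.
Qed.

End AssociatedBanachIdeal.

Theorem theorem2p1 (R : realType) (n : nat) (An : map_class R) (Nn : class_norm R)
    (hn : (0 < n)%N) (hAn : banach_ideal n An Nn) :
  exists A : map_class R,
    [/\ exists2 N : class_norm R,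
          banach_ideal 1 A N & compatible n An Nn A N,
        forall (A' : map_class R) (N' : class_norm R),
          banach_ideal 1 A' N' -> compatible n An Nn A' N' ->
          forall (E F : completeNormedModType R[i]) (T : E -> F),
            A' E F T <-> A E F T
      & exists N : class_norm R,
          normed_ideal 1 A N /\
          exists cA cB : R,
            [/\ 1 <= cA <= expR 1, 1 <= cB <= expR 1
              & compatible_with_constants n An Nn A N cA cB]].
Proof.
have [idealAn complAn] := hAn.
have idealA := mul_class_normed_ideal hn idealAn.
have compatA := mul_class_compatible hn idealAn.
have k1 := kappa_ge1 hn idealAn.
have e1 : 1 <= expR 1 :> R by apply: le_trans (expR_ge1Dx 1); rewrite lerDl.
exists (mul_class n An Nn); split.
- eexists; first by split; [exact: idealA|exact: mul_class_complete].
  exists (expR 1); eexists; split; last exact: compatA.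
    exact: expR_gt0.
  exact: lt_le_trans k1.
- move=> A' N' [idealA' _] compatA'.
  exact: (compatible_ideal_unique hn idealAn idealA' compatA').
- eexists; split; first exact: idealA.
  exists (expR 1); eexists; split; last exact: compatA.
    by rewrite e1 lexx.
  by rewrite k1 (kappa_le hn idealAn).
Qed.
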